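(* Suppose $T=(T_1,\ldots,T_d)\in\mathcal{B}(H)^d$ is a tuple of (not necessarily self-adjoint) contractions on a Hilbert space $H$. Then there is a normal dilation $N$ of $T$ with $\|N_i\|\le\sqrt{2d}$ for each $i$. It follows that $$\prod_{j=1}^d\mathcal{W}^{\min}(\overline{\mathbb{D}})\subseteq\sqrt{2d}\cdot\mathcal{W}^{\min}\big(\overline{\mathbb{D}}^d\big).$$
   Context: Let $\mathcal{M}^d=\bigcup_{n\ge1}M_n^d$, where $M_n^d$ is the set of $d$-tuples of complex $n\times n$ matrices. A tuple of operators is normal if its members are normal and commute with each other; $\sigma(N)$ denotes the joint spectrum of a normal tuple. $Y\in\mathcal{B}(L)^d$ is a dilation of $X\in\mathcal{B}(H)^d$ if there is an isometry $V:H\to L$ with $X_i=V^*Y_iV$ for all $i$. For a compact convex set $K\subseteq\mathbb{C}^d$, $\mathcal{W}^{\min}(K)$ is the set of $X\in\mathcal{M}^d$ having a normal dilation $N$ with $\sigma(N)\subseteq K$. $\overline{\mathbb{D}}\subset\mathbb{C}$ is the closed unit disk. The product of subsets $\mathcal{S}^j=\bigcup_n\mathcal{S}^j_n$ of matrix universes is the graded product $\prod_j\mathcal{S}^j:=\bigcup_{n\ge1}\prod_j\mathcal{S}^j_n$ (concatenation of tuples of matrices of the same size). *)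

(* Defs.v *)
From HB Require Import structures.
From mathcomp Require Import all_boot all_order all_algebra.
From mathcomp Require Import sesquilinear complex.
From mathcomp Require Import all_classical all_reals all_analysis.

Set Implicit Arguments.
Unset Strict Implicit.
Unset Printing Implicit Defensive.

Import Order.TTheory GRing.Theory Num.Theory numFieldNormedType.Exports.

Local Open Scope classical_set_scope.
Local Open Scope complex_scope.
Local Open Scope ring_scope.

(* The inner product is linear in its first argument and conjugate-linear in
   its second one. *)
Record hilbertType (R : realType) := HilbertType {
  hilbert_sort :> completeNormedModType R[i] ;
  inner : {dot hilbert_sort for Num.conj} ;
  innerxx : forall x, inner x x = `|x| ^+ 2
}.

Record bounded_operator (R : realType) (H L : hilbertType R) :=
  BoundedOperator {
  bounded_linear :> {linear H -> L} ;
  bounded_continuous : continuous bounded_linear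
}.

Notation "''B' ( H , L )" := (bounded_operator H L)
  (at level 8, format "''B' ( H ,  L )") : type_scope.

Lemma bounded_operator_ext (R : realType) (H L : hilbertType R) (A B : 'B(H, L)) :
  A =1 B -> A = B.
Proof.
case: A B => [A cA] [B cB] /= AB.
have E : A = B.
  case: A B AB {cA cB} => [A [[a1] [a2]]] [B [[b1] [b2]]] /= AB.
  move/funext: AB => AB; case: _ / AB in b1 b2 *.
  by congr (GRing.Linear.Pack (GRing.Linear.Class _ _)); congr (_ _);
    exact: Prop_irrelevance.
by case: _ / E in cB *; congr BoundedOperator; exact: Prop_irrelevance.
Qed.

Section Operations.
Context {R : realType}.
Implicit Types H L M : hilbertType R.

Lemma bid_continuous H : continuous (idfun : H -> H).
Proof. by move=> x. Qed.

Definition bid H : 'B(H, H) :=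
  @BoundedOperator R H H (idfun : {linear H -> H}) (@bid_continuous H).

Lemma bcomp_continuous H L M (A : 'B(L, M)) (B : 'B(H, L)) :
  continuous (A \o B).
Proof.
by move=> x; apply: continuous_comp; apply: bounded_continuous.
Qed.

Definition bcomp H L M (A : 'B(L, M)) (B : 'B(H, L)) : 'B(H, M) :=
  @BoundedOperator R H M (A \o B : {linear H -> M})
    (@bcomp_continuous H L M A B).

Lemma badd_continuous H L (A B : 'B(H, L)) : continuous (A \+ B).
Proof. by move=> x; apply: cvgD; apply: bounded_continuous. Qed.

Definition badd H L (A B : 'B(H, L)) : 'B(H, L) :=
  @BoundedOperator R H L (A \+ B : {linear H -> L}) (@badd_continuous H L A B).

Lemma bscale_continuous H L (c : R[i]) (A : 'B(H, L)) :
  continuous (c \*: A).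
Proof. by move=> x; apply: cvgZl_tmp; apply: bounded_continuous. Qed.

Definition bscale H L (c : R[i]) (A : 'B(H, L)) : 'B(H, L) :=
  @BoundedOperator R H L (c \*: A : {linear H -> L})
    (@bscale_continuous H L c A).

Definition opnorm H L (A : 'B(H, L)) : R :=
  sup [set complex.Re `|A x| | x in [set x : H | `|x| <= 1]].

Definition is_adjoint H L (A : 'B(H, L)) (B : 'B(L, H)) :=
  forall x y, inner L (A x) y = inner H x (B y).

Definition normal_operator H (A : 'B(H, H)) :=
  exists2 B, is_adjoint A B & bcomp A B = bcomp B A.

End Operations.

(* [Cn R n] is C^n with the Euclidean norm; the library norm of ['cV_n] is the
   sup norm. *)
Section EuclideanSpace.
Variables (R : realType) (n : nat).

Definition Cn : Type := 'cV[R[i]]_n.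

HB.instance Definition _ := GRing.Lmodule.copy Cn 'cV[R[i]]_n.
HB.instance Definition _ := Vector.copy Cn 'cV[R[i]]_n.

Definition Cn_dot (x y : Cn) : R[i] :=
  \sum_i (x : 'cV_n) i 0 * Num.conj ((y : 'cV_n) i 0).

Let Cn_dot_bilinear : bilinear_for *%R (Num.conj \; *%R) Cn_dot.
Proof.
split=> [y a u v|x a u v]; rewrite /Cn_dot /= mulr_sumr -big_split /=;
  apply: eq_bigr => i _; rewrite !mxE.
- by rewrite mulrDl mulrA.
- by rewrite rmorphD rmorphM /= mulrDr mulrCA.
Qed.

HB.instance Definition _ :=
  bilinear_isBilinear.Build R[i] Cn Cn R[i] *%R (Num.conj \; *%R) Cn_dot
    Cn_dot_bilinear.

Let Cn_dot_hermitian x y :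
  Cn_dot x y = (-1) ^+ false * Num.conj (Cn_dot y x).
Proof.
rewrite expr0 mul1r /Cn_dot rmorph_sum; apply: eq_bigr => i _ /=.
by rewrite rmorphM /= conjCK mulrC.
Qed.

HB.instance Definition _ :=
  isHermitianSesquilinear.Build R[i] Cn false Num.conj Cn_dot
    Cn_dot_hermitian.

Let Cn_dot_gt0 x : x != 0 -> 0 < Cn_dot x x.
Proof.
move=> x0; rewrite lt_def; apply/andP; split; last first.
  by apply: sumr_ge0 => i _; rewrite mul_conjC_ge0.
apply: contra x0 => /eqP x0; apply/eqP/matrixP => i j.
rewrite (ord1 j) mxE; apply/eqP; rewrite -mul_conjC_eq0.
have /psumr_eq0P := x0; move=> /(_ _ i isT) -> //.
by move=> k _; rewrite mul_conjC_ge0.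
Qed.

HB.instance Definition _ :=
  isDotProduct.Build R[i] Cn Cn_dot Cn_dot_gt0.

Definition Cn_norm (x : Cn) : R[i] := sqrtC (Cn_dot x x).

Let Cn_normD x y : Cn_norm (x + y) <= Cn_norm x + Cn_norm y.
Proof. exact: (triangle_lerif Cn_dot x y).1. Qed.

Let Cn_normZ l x : Cn_norm (l *: x) = `|l| * Cn_norm x.
Proof.
rewrite /Cn_norm (dnormZ Cn_dot) sqrtCM ?nnegrE ?exprn_ge0 ?dnorm_ge0 //.
by rewrite sqrCK.
Qed.

Let Cn_norm0 x : Cn_norm x = 0 -> x = 0.
Proof.
by move=> /eqP; rewrite sqrtC_eq0 (dnorm_eq0 Cn_dot) => /eqP.
Qed.

HB.instance Definition _ :=
  Lmodule_isNormed.Build R[i] Cn Cn_normD Cn_normZ Cn_norm0.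

Lemma Cn_dotxx (x : Cn) : Cn_dot x x = `|x| ^+ 2.
Proof. by rewrite -[RHS]/(Cn_norm x ^+ 2) sqrtCK. Qed.

Lemma Cn_norm_coord (x : Cn) i : `|(x : 'cV_n) i 0| <= `|x|.
Proof.
rewrite -(@ler_pXn2r _ 2%N) ?nnegrE //; rewrite -Cn_dotxx.
rewrite /Cn_dot (bigD1 i) //= -normCK lerDl.
by apply: sumr_ge0 => j _; rewrite mul_conjC_ge0.
Qed.

Lemma Cn_norm_le_sum (x : Cn) : `|x| <= \sum_i `|(x : 'cV_n) i 0|.
Proof.
have -> : x = \sum_i (x : 'cV_n) i 0 *: (delta_mx i 0 : Cn).
  apply/matrixP => k j; rewrite (ord1 j) summxE (bigD1 k) //= big1 => [|i ik].
    by rewrite !mxE !eqxx mulr1 addr0.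
  by rewrite !mxE eq_sym (negPf ik) mulr0.
apply: le_trans (ler_norm_sum _ _ _) _.
have normd i : `|(delta_mx i 0 : Cn)| = 1.
  apply/eqP; rewrite -(@eqrXn2 _ 2%N) // -Cn_dotxx expr1n /Cn_dot.
  rewrite (bigD1 i) //= big1 => [|j ji]; rewrite !mxE.
    by rewrite !eqxx mul1r conjC1 addr0.
  by rewrite (negPf ji) mul0r.
rewrite le_eqVlt; apply/orP; left; apply/eqP; apply: eq_bigr => i _.
rewrite normrZ normd mulr1; congr `|_|.
rewrite summxE (bigD1 i) //= big1 => [|j ji].
  by rewrite !mxE !eqxx mulr1 addr0.
by rewrite !mxE eq_sym (negPf ji) mulr0.
Qed.

Let Cn_complete (F : set_system Cn) : ProperFilter F -> cauchy F -> cvg F.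
Proof.
move=> FF Fc.
have norm_i : `|'i%C : R[i]| = 1.
  by rewrite normc_def /= expr0n expr1n add0r sqrtr1.
have coord (p : R[i] -> R) :
    (forall z w : R[i], `|p z - p w|%:C <= `|z - w|) ->
    exists l : 'I_n -> R, forall i, p ((x : 'cV_n) i 0) @[x --> F] --> l i.
  move=> pP.
  suff /choice[l lP] : forall i, exists l : R,
      p ((x : 'cV_n) i 0) @[x --> F] --> l by exists l.
  move=> i; apply/cvg_ex; apply: (@cauchy_cvg R).
  apply/cauchy_ballP => e e0.
  have /cauchy_ballP/(_ (e%:C)) : cauchy F by [].
  rewrite ltcR => /(_ e0) [[A B] [FA FB] AB].
  exists ([set p ((x : 'cV_n) i 0) | x in A], [set p ((x : 'cV_n) i 0) | x in B]).
    by split; [apply: (filterS _ FA)|apply: (filterS _ FB)] => x xP /=; exists x.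
  move=> [_ _] /= [[x Ax <-] [y By <-]].
  have := AB (x, y) (conj Ax By); rewrite -ball_normE /= => xy.
  rewrite /ball /= -ltcR; apply: le_lt_trans (pP _ _) _.
  apply: le_lt_trans xy; apply: le_trans (Cn_norm_coord (x - y) i).
  by rewrite !mxE.
have [a aP] : exists l : 'I_n -> R,
    forall i, complex.Re ((x : 'cV_n) i 0) @[x --> F] --> l i.
  apply: coord => z w; apply: le_trans (normc_ge_Re (z - w)).
  by case: z w => [? ?] [? ?].
have [b bP] : exists l : 'I_n -> R,
    forall i, complex.Im ((x : 'cV_n) i 0) @[x --> F] --> l i.
  apply: coord => z w.
  have -> : `|z - w| = `|(z - w) * 'i%C|.
    by rewrite normrM norm_i mulr1.
  apply: le_trans (normc_ge_Re _); rewrite ReiNIm normrN.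
  by case: z w => [? ?] [? ?].
apply/cvg_ex; exists ((\col_i (a i +i* b i)) : Cn).
apply/cvgrPdist_le => -[e e'] /=; rewrite ltcE /= => /andP[/eqP-> e0].
have k0 : 0 < e / (n.*2.+1)%:R by rewrite divr_gt0.
have nearF : \forall x \near F, forall i,
    `|a i - complex.Re ((x : 'cV_n) i 0)| <= e / (n.*2.+1)%:R /\
    `|b i - complex.Im ((x : 'cV_n) i 0)| <= e / (n.*2.+1)%:R.
  apply: filter_forall => i; apply: filterI.
  - by have /cvgrPdist_le/(_ _ k0) := aP i.
  - by have /cvgrPdist_le/(_ _ k0) := bP i.
apply: filterS nearF => x xP.
apply: le_trans (Cn_norm_le_sum _) _.
apply: (@le_trans _ _ (\sum_(i < n) (e / (n.*2.+1)%:R *+ 2)%:C)).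
  apply: ler_sum => i _; rewrite !mxE.
  case: (xP i); case: ((x : 'cV_n) i 0) => [u v] /= au bv.
  have -> : (a i +i* b i) - (u +i* v) = (a i - u)%:C + (b i - v)%:C * 'i%C.
    by simpc.
  apply: le_trans (ler_normD _ _) _; rewrite normrM.
  by rewrite norm_i mulr1 !normc_def /= !expr0n !addr0 !sqrtr_sqr -rmorphD lecR mulr2n lerD.
rewrite sumr_const card_ord -rmorphMn lecR -mulrnA mul2n -mulrnAr.
rewrite -[X in _ <= X]mulr1 ler_pM2l // -mulr_natl ler_pdivrMr // mul1r ler_nat.
exact: leqnSn.
Qed.

HB.instance Definition _ := Uniform_isComplete.Build Cn Cn_complete.

Definition Cn_hilbert : hilbertType R := @HilbertType R Cn Cn_dot Cn_dotxx.

Variable A : 'M[R[i]]_n.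

Definition mulCn (x : Cn) : Cn := A *m (x : 'cV_n).

Let mulCn_linear : linear mulCn.
Proof. by move=> c x y; rewrite /mulCn linearP. Qed.

HB.instance Definition _ :=
  GRing.isLinear.Build R[i] Cn Cn *:%R mulCn mulCn_linear.

Let mulCn_continuous : continuous (mulCn : Cn_hilbert -> Cn_hilbert).
Proof.
apply: (@bounded_linear_continuous _ Cn Cn mulCn).
apply/bounded_funP => r.
exists (\sum_i \sum_j `|A i j| * r) => x xr.
apply: le_trans (Cn_norm_le_sum _) _; apply: ler_sum => i _.
rewrite mxE; apply: le_trans (ler_norm_sum _ _ _) _; apply: ler_sum => j _.
rewrite normrM ler_wpM2l //; exact: le_trans (Cn_norm_coord x j) xr.
Qed.

Definition matrix_operator : 'B(Cn_hilbert, Cn_hilbert) :=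
  @BoundedOperator R Cn_hilbert Cn_hilbert mulCn mulCn_continuous.

End EuclideanSpace.

Section Dilations.
Variable R : realType.
Implicit Types H L : hilbertType R.

Record cstar_subalgebra H (S : set 'B(H, H)) : Prop := CstarSubalgebra {
  cstar_id : S (bid H) ;
  cstar_add : forall A B, S A -> S B -> S (badd A B) ;
  cstar_scale : forall c A, S A -> S (bscale c A) ;
  cstar_comp : forall A B, S A -> S B -> S (bcomp A B) ;
  cstar_adjoint : forall A B, is_adjoint A B -> S A -> S B ;
  cstar_closed : forall (A_ : nat -> 'B(H, H)) A, (forall k, S (A_ k)) ->
    opnorm (badd (A_ k) (bscale (-1) A)) @[k --> \oo] --> (0 : R) -> S A
}.

Definition generated_cstar d H (N : 'I_d -> 'B(H, H)) : set 'B(H, H) :=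
  smallest (@cstar_subalgebra H) (range N).

Definition normal_tuple d H (N : 'I_d -> 'B(H, H)) :=
  (forall i, normal_operator (N i)) /\
  (forall i j, bcomp (N i) (N j) = bcomp (N j) (N i)).

(* [lam] is in the joint spectrum of [N] when the ideal generated by the
   [N i - lam i] in the unital C*-algebra generated by [N] (which is
   commutative when [N] is normal) is proper.  Proper ideals being those
   contained in the kernel of a character, these [lam] are the tuples of the
   values at [N] of the characters of that algebra. *)
Definition joint_spectrum d H (N : 'I_d -> 'B(H, H)) : set ('I_d -> R[i]) :=
  [set lam | ~ exists2 B : 'I_d -> 'B(H, H),
    forall i, generated_cstar N (B i) &
    forall x, \sum_i B i (N i x - lam i *: x) = x].

Definition isometric H L (V : 'B(H, L)) := forall x, `|V x| = `|x|.

Definition is_dilation d H L (Y : 'I_d -> 'B(L, L)) (X : 'I_d -> 'B(H, H)) :=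
  exists (V : 'B(H, L)) (Vadj : 'B(L, H)),
    [/\ isometric V, is_adjoint V Vadj &
        forall i, X i = bcomp Vadj (bcomp (Y i) V)].

(* Component [n] is the part of the universe made of matrices of size
   [n.+1], so that empty matrices are excluded. *)
Definition matrix_universe (d : nat) :=
  forall n : nat, set ('I_d -> 'M[R[i]]_n.+1).

Definition Wmin d (K : set ('I_d -> R[i])) : matrix_universe d := fun n =>
  [set X | exists (L : hilbertType R) (N : 'I_d -> 'B(L, L)),
    [/\ normal_tuple N, joint_spectrum N `<=` K &
        is_dilation N (fun i => matrix_operator (X i))]].

Definition closed_polydisk d : set ('I_d -> R[i]) :=
  [set z | forall i, `|z i| <= 1].

Definition graded_product d (S : 'I_d -> matrix_universe 1) :
    matrix_universe d := fun n =>
  [set X | forall j, S j n (fun _ : 'I_1 => X j)].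

Definition universe_scale d (c : R) (S : matrix_universe d) :
    matrix_universe d := fun n =>
  [set (fun i => c%:C *: X i) | X in S n].

Definition universe_subset d (S S' : matrix_universe d) :=
  forall n, S n `<=` S' n.

End Dilations.

(* Main.v *)
(* Let w be a primitive 4d-th root of unity, c = 1 / sqrt (2d), and
     B_k = 1 + c \sum_j (w^(-(2j+1)k) T_j + w^((2j+1)k) T_j^* ).
   Averaged over k, B_k^2 is 1 + c^2 \sum_j (T_j T_j^* + T_j^* T_j), which is at
   most 2 and leaves a defect S^2, while the average of w^((2i+1)k) B_k^2 is
   2 c T_i: the exponents are odd and smaller than 2d, so all other frequencies
   are nonzero modulo 4d. Hence the operators (B_k^2 + S^2) / 8d form a
   positive operator valued measure with moments c T_i, and the diagonal
   unitaries U_i = (w^((2i+1)k))_k of its Naimark dilation are normal, commute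
   and dilate c T_i.

   For the inclusion, a normal N with spectrum in the closed disk is a
   contraction, so that compressions of such operators are contractions and the
   first part applies. The dilation U obtained satisfies U_i^(4d) = 1, which
   puts its joint spectrum in the polydisk. *)
Require Import Defs.
From HB Require Import structures.
From mathcomp Require Import all_boot all_order all_algebra.
From mathcomp Require Import complex sesquilinear.
From mathcomp Require Import all_classical all_reals all_analysis.
From mathcomp Require Import cyclic separable cyclotomic.
From mathcomp Require Import zify ring lra.

Set Implicit Arguments.
Unset Strict Implicit.
Unset Printing Implicit Defensive.

Import Order.TTheory GRing.Theory Num.Theory numFieldNormedType.Exports.

Local Open Scope classical_set_scope.
Local Open Scope complex_scope.
Local Open Scope ring_scope.

(** * Norms and inner products *)

(** The vector [f v v *: u - f u v *: v] is a multiple of the part of [u] orthogonal to [v]; its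
    square is [f v v] times the difference of the two sides. *)
Lemma dot_CauchySchwarz (C : numClosedFieldType) (U : lmodType C)
    (f : {dot U for Num.conj}) (u v : U) :
  `|f u v| ^+ 2 <= f u u * f v v.
Proof.
have [->|v0] := eqVneq v 0; first by rewrite !linear0r normr0 expr0n.
have fv : 0 < f v v by rewrite dnorm_gt0.
have : 0 <= f (f v v *: u - f u v *: v) (f v v *: u - f u v *: v).
  exact: dnorm_ge0.
suff -> : f (f v v *: u - f u v *: v) (f v v *: u - f u v *: v) =
    f v v * (f u u * f v v - `|f u v| ^+ 2).
  by rewrite pmulr_rge0 // subr_ge0.
have fZl c x y : f (c *: x) y = c * f x y by exact: linearZl_LR.
have fZr c x y : f x (c *: y) = Num.conj c * f x y by exact: linearZr_LR.
have fBl x y z : f (x - y) z = f x z - f y z by exact: linearBl.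
have fBr x y z : f z (x - y) = f z x - f z y by exact: linearBr.
have fC : f v u = Num.conj (f u v) by rewrite hermC expr0 mul1r.
rewrite fBl !fBr !fZl !fZr fC.
by rewrite (geC0_conj (ltW fv)) normCK /=; ring.
Qed.

Lemma dot_triangle (C : numClosedFieldType) (U : lmodType C)
    (f : {dot U for Num.conj}) (u v : U) :
  sqrtC (f (u + v) (u + v)) <= sqrtC (f u u) + sqrtC (f v v).
Proof.
rewrite -ler_sqr ?nnegrE ?addr_ge0 ?sqrtC_ge0 ?dnorm_ge0 //.
rewrite sqrrD !sqrtCK addrAC dnormD lerD2l -[leRHS]mulr_natr.
rewrite -[leLHS](divfK (negbT (pnatr_eq0 C 2))) ler_pM2r ?ltr0n //.
have := (leif_Re_Creal (f u v)).1; rewrite ReE => /le_trans; apply.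
rewrite -(sqrCK (normr_ge0 _)) -sqrtCM ?nnegrE ?dnorm_ge0 //.
by rewrite ler_sqrtC ?nnegrE ?mulr_ge0 ?dnorm_ge0 ?exprn_ge0 //
    dot_CauchySchwarz.
Qed.

Section Norms.
Context {R : realType}.

(** Library norms are elements of [R[i]]; [nrm] is the same number in the real field, where [lra]
    and [nra] apply. *)
Definition nrm (V : normedZmodType R[i]) (x : V) : R := complex.Re `|x|.

Lemma nrmE (V : normedZmodType R[i]) (x : V) : `|x| = (nrm x)%:C.
Proof. by rewrite RRe_real // normr_real. Qed.

Lemma nrm_ge0 (V : normedZmodType R[i]) (x : V) : 0 <= nrm x.
Proof. by rewrite -ler0c -nrmE. Qed.

Lemma nrm0 (V : normedZmodType R[i]) : nrm (0 : V) = 0.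
Proof. by rewrite /nrm normr0. Qed.

Lemma nrm_eq0 (V : normedZmodType R[i]) (x : V) : (nrm x == 0) = (x == 0).
Proof. by rewrite -[RHS]normr_eq0 nrmE (inj_eq (@complexI R)). Qed.

Lemma nrmD (V : normedZmodType R[i]) (x y : V) : nrm (x + y) <= nrm x + nrm y.
Proof. by rewrite -lecR rmorphD /= -!nrmE ler_normD. Qed.

Lemma nrmN (V : normedZmodType R[i]) (x : V) : nrm (- x) = nrm x.
Proof. by rewrite /nrm normrN. Qed.

Lemma nrmB (V : normedZmodType R[i]) (x y : V) : nrm (x - y) <= nrm x + nrm y.
Proof. by rewrite -(nrmN y) nrmD. Qed.

Lemma nrm_distC (V : normedZmodType R[i]) (x y : V) : nrm (x - y) = nrm (y - x).
Proof. by rewrite /nrm distrC. Qed.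

Lemma nrm_sum (V : normedZmodType R[i]) (I : finType) (F : I -> V) :
  nrm (\sum_i F i) <= \sum_i nrm (F i).
Proof.
elim/big_ind2 : _ => [|x a y b xa yb|//]; first by rewrite nrm0.
by apply: le_trans (nrmD _ _) _; apply: lerD.
Qed.

Lemma nrmM (a b : R[i]) : nrm (a * b) = nrm a * nrm b.
Proof. by apply: complexI; rewrite rmorphM /= -!nrmE normrM. Qed.

Lemma nrmX (a : R[i]) n : nrm (a ^+ n) = nrm a ^+ n.
Proof. by apply: complexI; rewrite rmorphXn /= -!nrmE normrX. Qed.

Lemma nrm_real (a : R) : nrm (a%:C) = `|a|.
Proof.
by rewrite /nrm normc_def /= expr0n addr0 sqrtr_sqr.
Qed.

Lemma nrmZ (V : normedModType R[i]) (c : R[i]) (x : V) :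
  nrm (c *: x) = nrm c * nrm x.
Proof. by apply: complexI; rewrite rmorphM /= -!nrmE normrZ. Qed.

Lemma Re_le_nrm (a : R[i]) : `|complex.Re a| <= nrm a.
Proof. by rewrite -lecR -nrmE normc_ge_Re. Qed.

End Norms.

(** * Inner products, bounded operators and limits *)

Section Inner.
Context {R : realType}.
Implicit Types H L : hilbertType R.

Lemma innerDl H (x y z : H) : inner H (x + y) z = inner H x z + inner H y z.
Proof. exact: linearDl. Qed.

Lemma innerNl H (x y : H) : inner H (- x) y = - inner H x y.
Proof. exact: linearNl. Qed.

Lemma inner0l H (y : H) : inner H 0 y = 0.
Proof. exact: linear0l. Qed.

Lemma inner0r H (y : H) : inner H y 0 = 0.
Proof. exact: linear0r. Qed.

Lemma innerDr H (x y z : H) : inner H z (x + y) = inner H z x + inner H z y.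
Proof. exact: linearDr. Qed.

Lemma innerBl H (x y z : H) : inner H (x - y) z = inner H x z - inner H y z.
Proof. exact: linearBl. Qed.

Lemma innerBr H (x y z : H) : inner H z (x - y) = inner H z x - inner H z y.
Proof. exact: linearBr. Qed.

Lemma innerZl H (c : R[i]) (x y : H) : inner H (c *: x) y = c * inner H x y.
Proof. exact: linearZl_LR. Qed.

Lemma innerZr H (c : R[i]) (x y : H) :
  inner H x (c *: y) = Num.conj c * inner H x y.
Proof. exact: linearZr_LR. Qed.

Lemma inner_suml H (I : finType) (F : I -> H) (y : H) :
  inner H (\sum_i F i) y = \sum_i inner H (F i) y.
Proof. exact: linear_sumlz. Qed.

Lemma innerC H (x y : H) : inner H x y = Num.conj (inner H y x).
Proof. by rewrite hermC expr0 mul1r. Qed.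

Lemma inner_ext H (x y : H) : (forall z, inner H x z = inner H y z) -> x = y.
Proof.
move=> xy; apply/eqP; rewrite -subr_eq0 -nrm_eq0 -sqrf_eq0.
rewrite -(inj_eq (@complexI R)) rmorphXn /= -nrmE -innerxx.
by rewrite innerBl xy subrr.
Qed.

Lemma inner_extr H (x y : H) : (forall z, inner H z x = inner H z y) -> x = y.
Proof. by move=> xy; apply: inner_ext => z; rewrite innerC xy -innerC. Qed.

Lemma innerxx_nrm H (x : H) : inner H x x = (nrm x ^+ 2)%:C.
Proof. by rewrite innerxx nrmE rmorphXn. Qed.

Lemma inner_le H (x y : H) : nrm (inner H x y) <= nrm x * nrm y.
Proof.
rewrite -(@ler_pXn2r _ 2%N) ?nnegrE ?mulr_ge0 ?nrm_ge0 //.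
rewrite exprMn -lecR [leRHS]rmorphM /= -!innerxx_nrm rmorphXn /= -nrmE.
exact: dot_CauchySchwarz.
Qed.

Lemma nrm_sqrD H (x y : H) :
  nrm (x + y) ^+ 2 = nrm x ^+ 2 + nrm y ^+ 2 + 2 * complex.Re (inner H x y).
Proof.
apply: complexI; rewrite -innerxx_nrm innerDl !innerDr !innerxx_nrm
    (innerC y x).
rewrite !rmorphD rmorphM /=.
case: (inner H x y) => a b /=; apply/eqP; rewrite eq_complex /=.
by apply/andP; split; apply/eqP; ring.
Qed.

Lemma nrm_sqrB H (x y : H) :
  nrm (x - y) ^+ 2 = nrm x ^+ 2 + nrm y ^+ 2 - 2 * complex.Re (inner H x y).
Proof.
rewrite nrm_sqrD nrmN -scaleN1r innerZr rmorphN1 mulN1r.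
by case: (inner H x y) => a b /=; ring.
Qed.

Lemma bounded_nrm H L (A : 'B(H, L)) :
  exists2 c : R, 0 <= c & forall x, nrm (A x) <= c * nrm x.
Proof.
have /linear_bounded_continuous/linear_boundedP := @bounded_continuous _ _ _ A.
move=> [M [Mr MP]].
have /complex_realP[m mE] := Mr.
exists (`|m| + 1) => [|x]; first by rewrite addr_ge0.
have /MP/(_ x) : M < (`|m| + 1)%:C.
  by rewrite mE ltcR; apply: le_lt_trans (ler_norm m) _; rewrite ltrDl.
by rewrite !nrmE -rmorphM lecR.
Qed.

Lemma bounded_op H L (f : H -> L) (c : R) : linear f ->
  (forall x, nrm (f x) <= c * nrm x) -> exists B : 'B(H, L), B =1 f.
Proof.
move=> lf fc.
pose g : {linear H -> L} := HB.pack f (GRing.isLinear.Build R[i] H L *:%R f lf).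
have gc : continuous g.
  apply: bounded_linear_continuous; apply/linear_boundedP.
  exists `|c|%:C; split; first by apply/complex_realP; exists `|c|.
  move=> M cM x; apply: (@le_trans _ _ (`|c|%:C * `|x|)); last first.
    by apply: ler_wpM2r => //; exact: ltW.
  rewrite !nrmE -rmorphM lecR; apply: le_trans (fc x) _.
  by apply: ler_wpM2r; [exact: nrm_ge0|exact: ler_norm].
by exists (BoundedOperator gc).
Qed.

Lemma nrm_opnorm H L (A : 'B(H, L)) x : nrm (A x) <= opnorm A * nrm x.
Proof.
have [c c0 Ac] := bounded_nrm A.
have supA : has_sup [set complex.Re `|A x| | x in [set x : H | `|x| <= 1]].
  split; first by exists (complex.Re `|A 0|); exists 0 => //=; rewrite normr0.
  exists c => _ [y /= y1 <-]; apply: le_trans (Ac y) _.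
  by rewrite -[leRHS]mulr1; apply: ler_wpM2l => //; rewrite -lecR -nrmE.
have [->|x0] := eqVneq x 0; first by rewrite linear0 !nrm0 mulr0.
have nx : 0 < nrm x by rewrite lt_def nrm_ge0 nrm_eq0 x0.
rewrite -ler_pdivrMr //.
have -> : nrm (A x) / nrm x = nrm (A ((nrm x)^-1%:C *: x)).
  by rewrite linearZ nrmZ nrm_real ger0_norm ?invr_ge0 ?nrm_ge0 // mulrC.
apply: ub_le_sup; first exact: supA.2.
exists ((nrm x)^-1%:C *: x) => //=.
by rewrite nrmE nrmZ nrm_real ger0_norm ?invr_ge0 ?nrm_ge0 // mulVf ?gt_eqF.
Qed.

Lemma opnorm_le H L (A : 'B(H, L)) (c : R) : 0 <= c ->
  (forall x, nrm (A x) <= c * nrm x) -> opnorm A <= c.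
Proof.
move=> c0 Ac; apply: ge_sup.
  by exists (complex.Re `|A 0|); exists 0 => //=; rewrite normr0.
move=> _ [y /= y1 <-]; apply: le_trans (Ac y) _.
by rewrite -[leRHS]mulr1; apply: ler_wpM2l => //; rewrite -lecR -nrmE.
Qed.

(** An explicit rate survives in the limit; this serves both the Riesz representation and the square
    root. *)
Lemma cauchy_limit H (u : nat -> H) (b : nat -> R) :
  b n @[n --> \oo] --> 0 ->
  (forall n m, (n <= m)%N -> nrm (u m - u n) <= b n) ->
  exists l, forall n, nrm (l - u n) <= b n.
Proof.
move=> b0 ub.
have ucauchy : cauchy (u n @[n --> \oo]).
  apply/cauchy_ballP => -[e e'] /=; rewrite ltcE /= => /andP[/eqP-> e0].
  have [N _ NP] : \forall n \near \oo, `|0 - b n| < e / 2.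
    by have /cvgrPdist_lt := b0; apply; rewrite divr_gt0.
  have bN : b N < e / 2.
    by have := NP N (leqnn N); rewrite sub0r normrN; apply: le_lt_trans;
        exact: ler_norm.
  (* This ball contains the tail of [u] from [N] on, and any two of its points are less than [e]
     apart. *)
  pose A := [set x : H | nrm (x - u N) <= b N].
  have FA : (u n @[n --> \oo]) A by exists N => // n; exact: ub.
  exists (A, A) => //= -[x y] [/= Ax Ay].
  rewrite -ball_normE /= nrmE ltcR.
  have -> : x - y = (x - u N) - (y - u N) by rewrite opprB addrA subrK.
  apply: le_lt_trans (nrmB _ _) _.
  by have := Ax; have := Ay; rewrite /A /=; lra.
have /cauchy_cvg/cvg_ex[l lP] := ucauchy; exists l => n.
apply/ler_addgt0Pl => e e0.
have /cvgrPdist_lt/(_ e%:C) := lP; rewrite ltcR => /(_ e0) [N _ NP].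
have := NP (maxn N n) (leq_maxl _ _); rewrite nrmE ltcR => lu.
have -> : l - u n = (l - u (maxn N n)) + (u (maxn N n) - u n)
    by rewrite addrA subrK.
apply: le_trans (nrmD _ _) _; apply: lerD; first exact: ltW.
by apply: ub; exact: leq_maxr.
Qed.

End Inner.

(* Testing against an arbitrary vector turns an identity between vectors into
   one between scalars. *)
Ltac hilbert_ring := apply: inner_ext => ?;
  rewrite ?(innerDl, innerNl, innerZl, inner0l); ring.

(** * Adjoints and square roots *)

Section Riesz.
Context {R : realType}.
Implicit Types H L : hilbertType R.

Lemma le0_lim (a K : R) (b : nat -> R) :
  b n @[n --> \oo] --> 0 -> (forall n, a <= K * b n) -> a <= 0.
Proof.
move=> b0 aK.
have : K * b n @[n --> \oo] --> K * 0 by apply: cvgMr.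
rewrite mulr0 => Kb; rewrite -(cvg_lim (@Rhausdorff R) Kb).
by apply: limr_ge; [apply/cvg_ex; exists 0|exact: nearW].
Qed.

(** A representing vector [z] would turn [nrm x ^+ 2 - 2 * Re (f x)] into
    [nrm (x - z) ^+ 2 - nrm z ^+ 2], so [z] is sought as the minimiser of this functional [J]. *)
Lemma riesz H (f : H -> R[i]) (c : R) : linear_for *%R f ->
  (forall x, nrm (f x) <= c * nrm x) ->
  exists z, forall x, f x = inner H x z.
Proof.
move=> lf fc.
have f0 : f 0 = 0 by have := lf (-1) 0 0; rewrite scaler0 addr0 mulN1r addNr.
have fZ a x : f (a *: x) = a * f x by rewrite -[a *: x]addr0 lf f0 addr0.
have fD x y : f (x + y) = f x + f y by rewrite -[x]scale1r lf scale1r mul1r.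
pose J x := nrm x ^+ 2 - 2 * complex.Re (f x).
pose E := range J.
have infE : has_inf E.
  split; first by exists (J 0); exists 0.
  exists (- c ^+ 2) => _ [x _ <-]; rewrite /J.
  have := Re_le_nrm (f x); have := fc x; have := ler_norm (complex.Re (f x)).
  have := sqr_ge0 (nrm x - c); nra.
pose m := inf E.
pose e n : R := n.+1%:R^-1.
have e0 n : 0 < e n by rewrite invr_gt0.
have mJ x : m <= J x by apply: ge_inf; [exact: infE.2|exists x].
(* The excess over the infimum is [e n ^+ 2], so that distances come out of order [e n]. *)
have /choice[x xP] : forall n, exists x, J x < m + e n ^+ 2.
  move=> n; have e2 : 0 < e n ^+ 2 by rewrite exprn_gt0.
  by have [_ [x _ <-] Jx] := inf_adherent e2 infE; exists x.
have ReD (a b : R[i]) : complex.Re (a + b) = complex.Re a + complex.Re b.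
  by case: a b => [? ?] [? ?].
have ReZ (t : R) (a : R[i]) : complex.Re (t%:C * a) = t * complex.Re a.
  by case: a => [? ?] /=; rewrite mul0r subr0.
(* Parallelogram law: as [J] is at least [m] at the midpoint, the squared distance is at most
   [2 * (e k ^+ 2 + e n ^+ 2)]. *)
have xC n k : (n <= k)%N -> nrm (x k - x n) <= 2 * e n.
  move=> nk; have ekn : e k <= e n by rewrite lef_pV2 ?posrE ?ler_nat.
  have := mJ ((2^-1)%:C *: (x k + x n)).
  rewrite /J fZ fD nrmZ nrm_real ReZ ReD ger0_norm ?invr_ge0//.
  have := nrm_sqrD (x k) (x n); have := nrm_sqrB (x k) (x n).
  have := xP k; have := xP n; rewrite /J => Jn Jk dB dD mid.
  have ek2 : e k ^+ 2 <= e n ^+ 2 by rewrite ler_pXn2r // nnegrE ltW.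
  rewrite -(@ler_pXn2r _ 2%N) ?nnegrE ?nrm_ge0// ?exprMn; last first.
    by rewrite mulr_ge0 // ltW.
  rewrite exprMn exprVn in mid.
  by lra.
have e_0 : e n @[n --> \oo] --> 0 by exact: cvg_harmonic.
have [z zP] : exists z, forall n, nrm (z - x n) <= 2 * e n.
  apply: (@cauchy_limit _ _ _ (fun n => 2 * e n)) => //.
  by rewrite -[0 in X in _ --> X](mulr0 2); apply: cvgMr.
have key w : complex.Re (f w) = complex.Re (inner H w z).
  apply/eqP; rewrite -subr_eq0 -normr_le0.
  apply: (le0_lim (K := 3 * nrm w) e_0) => n.
  have zx : `|complex.Re (inner H w (x n)) - complex.Re (inner H w z)|
      <= nrm w * (2 * e n).
    have -> : complex.Re (inner H w (x n)) - complex.Re (inner H w z)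
        = complex.Re (inner H w (x n - z)).
      by rewrite innerBr; case: (inner H w (x n)) (inner H w z) => [? ?] [? ?].
    apply: le_trans (Re_le_nrm _) _; apply: le_trans (inner_le _ _) _.
    by apply: ler_wpM2l; [exact: nrm_ge0|rewrite nrm_distC].
  have fx : `|complex.Re (f w) - complex.Re (inner H w (x n))| <= nrm w * e n.
    set g := _ - _.
    have [w0|w0] := eqVneq w 0.
      by rewrite /g w0 f0 inner0l subrr normr0 nrm0 mul0r.
    have W0 : 0 < nrm w by rewrite lt_def nrm_ge0 nrm_eq0 w0.
    (* This [t] minimises [J (x n + t w)], which lies [g ^+ 2 / nrm w ^+ 2] below [J (x n)];
       near-minimality of [x n] bounds that drop by [e n ^+ 2]. *)
    pose t := g / nrm w ^+ 2.
    have := mJ (x n + t%:C *: w); have := xP n.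
    rewrite /J nrm_sqrD fD fZ ReD ReZ nrmZ nrm_real exprMn real_normK
        ?num_real//.
    rewrite innerZr (_ : Num.conj t%:C = t%:C); last first.
      by apply/CrealP; apply/complex_realP; exists t.
    rewrite ReZ innerC.
    have -> : complex.Re (Num.conj (inner H w (x n)))
        = complex.Re (inner H w (x n)).
      by case: (inner H w (x n)).
    move=> Jx mJt.
    have gt : g = t * nrm w ^+ 2 by rewrite /t divfK// expf_neq0 ?gt_eqF.
    have gE : g = complex.Re (f w) - complex.Re (inner H w (x n)) by [].
    rewrite -(@ler_pXn2r _ 2%N) ?nnegrE// ?exprMn; last first.
      by rewrite mulr_ge0 ?nrm_ge0 // ltW.
    rewrite real_normK ?num_real//.
    have : t ^+ 2 * nrm w ^+ 2 <= e n ^+ 2.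
      have : t * g = t ^+ 2 * nrm w ^+ 2 by rewrite gt; ring.
      by rewrite {1}gE; lra.
    have -> : g ^+ 2 = nrm w ^+ 2 * (t ^+ 2 * nrm w ^+ 2) by rewrite [in LHS]gt;
        ring.
    move=> tw.
    by apply: ler_wpM2l => //; exact: sqr_ge0.
  have -> : complex.Re (f w) - complex.Re (inner H w z)
      = (complex.Re (f w) - complex.Re (inner H w (x n))) +
    (complex.Re (inner H w (x n)) - complex.Re (inner H w z)) by ring.
  apply: le_trans (ler_normD _ _) _; move: zx fx; lra.
exists z => w; apply/eqP; rewrite eq_complex key eqxx /=; apply/eqP.
(* Real parts at ['i w] are, up to sign, imaginary parts at [w]. *)
have := key ('i%C *: w); rewrite fZ innerZl !(mulrC 'i%C) !ReiNIm.
by move/oppr_inj.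
Qed.

(** The square of [nrm (B y)] is the inner product of [A (B y)] and [y], hence at most
    [c * nrm (B y) * nrm y]. Plain functions are allowed because the bound is what makes the adjoint
    a bounded operator. *)
Lemma adjoint_bound H L (A : H -> L) (B : L -> H) (c : R) : 0 <= c ->
  (forall x y, inner L (A x) y = inner H x (B y)) ->
  (forall x, nrm (A x) <= c * nrm x) -> forall y, nrm (B y) <= c * nrm y.
Proof.
move=> c0 AB Ac y; have [By0|By0] := eqVneq (B y) 0.
  by rewrite By0 nrm0 mulr_ge0 ?nrm_ge0.
have nBy : 0 < nrm (B y) by rewrite lt_def nrm_ge0 nrm_eq0 By0.
rewrite -(ler_pM2l nBy) -expr2.
have -> : nrm (B y) ^+ 2 = nrm (inner L (A (B y)) y).
  by rewrite AB innerxx_nrm nrm_real ger0_norm ?sqr_ge0.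
apply: le_trans (inner_le _ _) _; rewrite mulrA; apply: ler_wpM2r.
  exact: nrm_ge0.
by rewrite mulrC.
Qed.

Lemma adjoint_exists H L (A : 'B(H, L)) : exists B, is_adjoint A B.
Proof.
have [c c0 Ac] := bounded_nrm A.
have /choice[B AB] : forall y, exists z, forall x, inner L (A x) y
    = inner H x z.
  move=> y; apply: (@riesz _ _ (c * nrm y)) => [a u v|x].
    by rewrite linearP innerDl innerZl.
  apply: le_trans (inner_le _ _) _; rewrite mulrAC; apply: ler_wpM2r => //.
  exact: nrm_ge0.
have lB : linear B.
  by move=> a u v; apply: inner_extr => x;
      rewrite -AB innerDr innerZr !AB -innerZr -innerDr.
have [B' B'E] := bounded_op lB (adjoint_bound c0 (fun x y => AB y x) Ac).
by exists B' => x y; rewrite B'E AB.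
Qed.

(* [S] is [1 - Y] for the limit [Y] of the iteration [Y := (A + Y^2) / 2], which
   converges because its increments are dominated in norm by those of the scalar
   iteration [s := (1 + s^2) / 2]. *)
Lemma sqrt_exists H (A : 'B(H, H)) : is_adjoint A A ->
  (forall x, nrm (A x) <= nrm x) ->
  exists2 S : 'B(H, H), is_adjoint S S & forall x, S (S x) = x - A x.
Proof.
move=> AA A1.
pose h : R[i] := (2^-1)%:C.
have nh : nrm h = 2^-1 by rewrite nrm_real ger0_norm ?invr_ge0.
pose Y := fix Y n x := if n is k.+1 then h *: (A x + Y k (Y k x)) else 0 : H.
pose s := fix s n : R := if n is k.+1 then (1 + s k ^+ 2) / 2 else 0.
have s01 n : 0 <= s n <= 1.
  elim: n => [|n /andP[n0 n1]] /=; first by rewrite lexx ler01.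
  by apply/andP; split; nra.
have sS n : s n <= s n.+1 by have := sqr_ge0 (s n - 1); rewrite /=; lra.
have s_mono : nondecreasing_seq s by apply/nondecreasing_seqP.
have Ylin n : linear (Y n).
  elim: n => [|n IH] a u v /=; first by rewrite scaler0 addr0.
  by rewrite !IH linearP; hilbert_ring.
have YB n u v : Y n (u - v) = Y n u - Y n v.
  by rewrite addrC -scaleN1r Ylin scaleN1r addrC.
have Yadj n u v : inner H (Y n u) v = inner H u (Y n v).
  elim: n u v => [|n IH] u v /=.
    by rewrite inner0l inner0r.
  rewrite innerZl innerZr innerDl innerDr AA !IH; congr (_ * _).
  by apply/esym/CrealP; apply/complex_realP; exists 2^-1.
have Ys n u : nrm (Y n u) <= s n * nrm u.
  elim: n u => [|n IH] u /=; first by rewrite nrm0 mul0r.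
  rewrite nrmZ nh; have := nrmD (A u) (Y n (Y n u)); have := A1 u.
  have : nrm (Y n (Y n u)) <= s n * (s n * nrm u).
    by apply: le_trans (IH _) _; apply: ler_wpM2l;
        [case/andP: (s01 n)|exact: IH].
  rewrite mulrA -expr2; lra.
have YS n u : nrm (Y n.+1 u - Y n u) <= (s n.+1 - s n) * nrm u.
  elim: n u => [|n IH] u.
    rewrite /= addr0 subr0 nrmZ nh expr0n /=.
    by have := A1 u; lra.
  rewrite [Y n.+2]/= [X in _ - X]/= -scalerBr nrmZ nh.
  set p := Y n.+1; set q := Y n.
  (* The splitting [p^2 - q^2 = p (p - q) + (p - q) q] has the scalar bound
     [s n.+1 ^+ 2 - s n ^+ 2], which is twice the next increment of [s]. *)
  have -> : A u + p (p u) - (A u + q (q u))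
      = p (p u - q u) + (p (q u) - q (q u)).
    by rewrite [p (_ - _)](YB n.+1); hilbert_ring.
  apply: (@le_trans _ _ (2^-1 * (s n.+1 * ((s n.+1 - s n) * nrm u)
      + (s n.+1 - s n) * (s n * nrm u)))).
    apply: ler_wpM2l; first by rewrite invr_ge0.
    apply: le_trans (nrmD _ _) _; apply: lerD.
      apply: le_trans (Ys _ _) _; apply: ler_wpM2l; last exact: IH.
      by case/andP: (s01 n.+1).
    apply: le_trans (IH _) _; apply: ler_wpM2l; last exact: Ys.
    by rewrite subr_ge0.
  have -> : s n.+2 = (1 + s n.+1 ^+ 2) / 2 by [].
  have e1 : s n.+1 = (1 + s n ^+ 2) / 2 by [].
  have e2 : s n ^+ 2 = 2 * s n.+1 - 1 by rewrite e1; field.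
  rewrite [leLHS](_ : _ = 2^-1 * (s n.+1 ^+ 2 - s n ^+ 2) * nrm u);
      last by ring.
  by rewrite e2 le_eqVlt; apply/orP; left; apply/eqP; field.
have Ydist n m u : (n <= m)%N -> nrm (Y m u - Y n u) <= (s m - s n) * nrm u.
  move=> /subnK <-; elim: (m - n)%N => [|k IH];
      first by rewrite !subrr nrm0 mul0r.
  rewrite addSn; have -> : Y (k + n).+1 u - Y n u =
    (Y (k + n).+1 u - Y (k + n)%N u) + (Y (k + n)%N u - Y n u)
        by rewrite addrA subrK.
  by have := nrmD (Y (k + n).+1 u - Y (k + n)%N u) (Y (k + n)%N u - Y n u);
      have := YS (k + n)%N u; move: IH; lra.
have scvg : cvgn s.
  by apply: nondecreasing_is_cvgn => //; exists 1 => _ [k _ <-];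
      case/andP: (s01 k).
(* The tail [b] of the scalar iteration is a common rate of convergence for all the sequences
   [Y n u]. *)
pose l := limn s; pose b n := l - s n.
have b0 : b n @[n --> \oo] --> 0.
  by rewrite -(subrr l); apply: cvgB => //; exact: cvg_cst.
have sl n : s n <= l by exact: nondecreasing_cvgn_le.
have /choice[Z ZP] : forall u, exists z, forall n, nrm (z - Y n u)
    <= b n * nrm u.
  move=> u; apply: (@cauchy_limit _ _ _ (fun n => b n * nrm u)).
    by rewrite -[0 in X in _ --> X](mul0r (nrm u)); apply: cvgMl.
  move=> n m nm; apply: le_trans (Ydist _ _ _ nm) _; apply: ler_wpM2r.
    exact: nrm_ge0.
  by rewrite lerD2r.
have lim0 (V : normedZmodType R[i]) (v : V) (K : R)
    : (forall n, nrm v <= K * b n) -> v = 0.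
  by move=> /(le0_lim b0) v0; apply/eqP; rewrite -nrm_eq0 eq_le v0 nrm_ge0.
have Zlin : linear Z.
  move=> a u v; apply/eqP; rewrite -subr_eq0; apply/eqP.
  apply: (lim0 _ _ (nrm (a *: u + v) + nrm a * nrm u + nrm v)) => n.
  have -> : Z (a *: u + v) - (a *: Z u + Z v) =
    (Z (a *: u + v) - Y n (a *: u + v)) - a *: (Z u - Y n u) - (Z v - Y n v).
    by rewrite Ylin; hilbert_ring.
  have := nrmB (Z (a *: u + v) - Y n (a *: u + v) - a *: (Z u - Y n u))
      (Z v - Y n v).
  have := nrmB (Z (a *: u + v) - Y n (a *: u + v)) (a *: (Z u - Y n u)).
  have := ZP (a *: u + v) n; have := ZP v n.
  have : nrm (a *: (Z u - Y n u)) <= nrm a * (b n * nrm u).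
    by rewrite nrmZ; apply: ler_wpM2l; [exact: nrm_ge0|exact: ZP].
  lra.
have Zle u : nrm (Z u) <= l * nrm u by have := ZP u 0%N; rewrite subr0 /b subr0.
have l0 : 0 <= l by exact: le_trans (sl 0%N).
(* The recursion becomes [2 Z = A + Z^2] in the limit, that is [(1 - Z)^2 = 1 - A]. *)
have ZZ u : A u + Z (Z u) = Z u + Z u.
  apply/eqP; rewrite -subr_eq0; apply/eqP.
  apply: (lim0 _ _ ((2 + 2 * l) * nrm u)) => n.
  have -> : A u + Z (Z u) - (Z u + Z u) =
    (Z (Z u) - Y n (Z u)) + Y n (Z u - Y n u) - 2%:R *: (Z u - Y n.+1 u).
    have -> : A u = 2%:R *: Y n.+1 u - Y n (Y n u).
      rewrite /= /h scalerA (_ : 2%:R * _ = 1) ?scale1r ?addrK//.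
      by rewrite -[2%:R](rmorph_nat (real_complex R)) -rmorphM divff//
          pnatr_eq0.
    by rewrite YB; hilbert_ring.
  have := nrmB ((Z (Z u) - Y n (Z u)) + Y n (Z u - Y n u))
      (2%:R *: (Z u - Y n.+1 u)).
  have := nrmD (Z (Z u) - Y n (Z u)) (Y n (Z u - Y n u)).
  have : nrm (Z (Z u) - Y n (Z u)) <= b n * (l * nrm u).
    apply: le_trans (ZP _ _) _; apply: ler_wpM2l => //; rewrite subr_ge0;
        exact: sl.
  have : nrm (Y n (Z u - Y n u)) <= l * (b n * nrm u).
    apply: le_trans (Ys _ _) _; apply: ler_pM; rewrite ?nrm_ge0//.
    by case/andP: (s01 n).
  have : nrm (2%:R *: (Z u - Y n.+1 u)) <= 2 * (b n * nrm u).
    rewrite nrmZ -[2%:R](rmorph_nat (real_complex R)) nrm_real normr_nat.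
    apply: ler_wpM2l => //; apply: le_trans (ZP _ _) _; apply: ler_wpM2r.
      exact: nrm_ge0.
    by rewrite lerD2l lerN2.
  lra.
have [S SE] := bounded_op Zlin Zle.
exists (badd (bid H) (bscale (-1) S)).
  move=> u v /=; rewrite !SE !scaleN1r innerBl innerBr; congr (_ - _).
  apply/eqP; rewrite -subr_eq0; apply/eqP.
  apply: (lim0 _ _ (2 * nrm u * nrm v)) => n.
  have -> : inner H (Z u) v - inner H u (Z v) =
      inner H (Z u - Y n u) v - inner H u (Z v - Y n v).
    by rewrite innerBl innerBr Yadj; ring.
  have := nrmB (inner H (Z u - Y n u) v) (inner H u (Z v - Y n v)).
  have : nrm (inner H (Z u - Y n u) v) <= (b n * nrm u) * nrm v.
    apply: le_trans (inner_le _ _) _; apply: ler_wpM2r => //; exact: nrm_ge0.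
  have : nrm (inner H u (Z v - Y n v)) <= nrm u * (b n * nrm v).
    apply: le_trans (inner_le _ _) _; apply: ler_wpM2l => //; exact: nrm_ge0.
  lra.
move=> u /=; rewrite !scaleN1r linearB !SE.
have -> : A u = Z u + Z u - Z (Z u) by rewrite -ZZ addrK.
hilbert_ring.
Qed.
End Riesz.

(** * Finite direct sums of Hilbert spaces *)

Section DirectSum.
Variables (R : realType) (H : hilbertType R) (I : finType).

(** The direct sum of copies of [H] gets its own name in order to carry the l^2 norm [hsum_norm]. *)
Definition hsum : Type := {ffun I -> H}.

HB.instance Definition _ := GRing.Lmodule.copy hsum {ffun I -> H}.

Implicit Types x y : hsum.

Lemma hsumD x y i : ((x + y : hsum) : {ffun I -> H}) i =
  (x : {ffun I -> H}) i + (y : {ffun I -> H}) i.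
Proof. by rewrite ffunE. Qed.

Lemma hsumZ (c : R[i]) x i : ((c *: x : hsum) : {ffun I -> H}) i =
  c *: (x : {ffun I -> H}) i.
Proof. by rewrite ffunE. Qed.

Definition hsum_dot x y : R[i] :=
  \sum_i inner H ((x : {ffun I -> H}) i) ((y : {ffun I -> H}) i).

Let hsum_dot_bilinear : bilinear_for *%R (Num.conj \; *%R) hsum_dot.
Proof.
split=> [y a u v|x a u v]; rewrite /hsum_dot /= mulr_sumr -big_split /=;
  apply: eq_bigr => i _; rewrite hsumD hsumZ.
- by rewrite innerDl innerZl.
- by rewrite innerDr innerZr.
Qed.

HB.instance Definition _ :=
  bilinear_isBilinear.Build R[i] hsum hsum R[i] *%R (Num.conj \; *%R) hsum_dot
    hsum_dot_bilinear.

Let hsum_dot_hermitian x y :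
  hsum_dot x y = (-1) ^+ false * Num.conj (hsum_dot y x).
Proof.
rewrite expr0 mul1r /hsum_dot rmorph_sum; apply: eq_bigr => i _ /=.
exact: innerC.
Qed.

HB.instance Definition _ :=
  isHermitianSesquilinear.Build R[i] hsum false Num.conj hsum_dot
    hsum_dot_hermitian.

Lemma hsum_dotxx x : hsum_dot x x = \sum_i `|(x : {ffun I -> H}) i| ^+ 2.
Proof. by apply: eq_bigr => i _; rewrite innerxx. Qed.

Let hsum_dot_gt0 x : x != 0 -> 0 < hsum_dot x x.
Proof.
move=> x0; rewrite hsum_dotxx lt_def; apply/andP; split; last first.
  by apply: sumr_ge0 => i _; rewrite exprn_ge0.
apply: contra x0 => /eqP x0; apply/eqP/ffunP => i; rewrite ffunE.
have /psumr_eq0P : \sum_i `|(x : {ffun I -> H}) i| ^+ 2 = 0 by [].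
move=> /(_ (fun i _ => exprn_ge0 2 (normr_ge0 _)) i isT) /eqP.
by rewrite sqrf_eq0 normr_eq0 => /eqP.
Qed.

HB.instance Definition _ :=
  isDotProduct.Build R[i] hsum hsum_dot hsum_dot_gt0.

Let hsum_dot_ge0 x : 0 <= hsum_dot x x.
Proof. by rewrite hsum_dotxx; apply: sumr_ge0 => i _; rewrite exprn_ge0. Qed.

Definition hsum_norm x : R[i] := sqrtC (hsum_dot x x).

Let hsum_normD x y : hsum_norm (x + y) <= hsum_norm x + hsum_norm y.
Proof. exact: (dot_triangle hsum_dot). Qed.

Let hsum_normZ l x : hsum_norm (l *: x) = `|l| * hsum_norm x.
Proof.
rewrite /hsum_norm (dnormZ hsum_dot) sqrtCM ?nnegrE ?exprn_ge0 ?dnorm_ge0 //.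
by rewrite sqrCK.
Qed.

Let hsum_norm0 x : hsum_norm x = 0 -> x = 0.
Proof.
move=> /eqP; rewrite sqrtC_eq0 => /eqP x0; apply/eqP/contraT => /hsum_dot_gt0.
by rewrite x0 ltxx.
Qed.

HB.instance Definition _ :=
  Lmodule_isNormed.Build R[i] hsum hsum_normD hsum_normZ hsum_norm0.

Let hsum_dot_norm x : hsum_dot x x = `|x| ^+ 2.
Proof. by rewrite -[RHS]/(hsum_norm x ^+ 2) sqrtCK. Qed.

Let hsum_norm_coord x i : `|(x : {ffun I -> H}) i| <= `|x|.
Proof.
rewrite -(@ler_pXn2r _ 2%N) ?nnegrE // -hsum_dot_norm hsum_dotxx.
rewrite (bigD1 i) //= lerDl.
by apply: sumr_ge0 => j _; rewrite exprn_ge0.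
Qed.

(** The factor [#|I|.+1] is cruder than a square root, but it is positive even for empty [I], so the
    completeness proof can divide by it. *)
Let hsum_norm_le x (e : R[i]) : 0 <= e ->
  (forall i, `|(x : {ffun I -> H}) i| <= e) -> `|x| <= #|I|.+1%:R * e.
Proof.
move=> e0 xe; rewrite -(@ler_pXn2r _ 2%N) ?nnegrE ?mulr_ge0//.
rewrite -hsum_dot_norm hsum_dotxx.
apply: (@le_trans _ _ (\sum_(i : I) e ^+ 2)).
  by apply: ler_sum => i _; rewrite ler_pXn2r ?nnegrE.
rewrite sumr_const exprMn -[leLHS]mulr_natl ler_wpM2r ?exprn_ge0// -natrX
    ler_nat.
by rewrite (leq_trans (leqnSn _))// leq_pmull.
Qed.

Let hsum_complete (F : set_system hsum) : ProperFilter F -> cauchy F -> cvg F.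
Proof.
move=> FF Fc.
have /choice[l lP] : forall i, exists l : H,
    (x : {ffun I -> H}) i @[x --> F] --> l.
  move=> i; apply/cvg_ex; apply: cauchy_cvg; apply/cauchy_ballP => e e0.
  have /cauchy_ballP/(_ e e0) [[A B] [FA FB] AB] : cauchy F by [].
  exists ([set (x : {ffun I -> H}) i | x in A],
          [set (x : {ffun I -> H}) i | x in B]).
    by split; [apply: (filterS _ FA)|apply: (filterS _ FB)] => x xP /=;
        exists x.
  move=> [_ _] /= [[x Ax <-] [y By <-]].
  have := AB (x, y) (conj Ax By); rewrite -!ball_normE /=; apply: le_lt_trans.
  have -> : (x : {ffun I -> H}) i - (y : {ffun I -> H}) i =
    ((x - y : hsum) : {ffun I -> H}) i by rewrite !ffunE.
  exact: hsum_norm_coord.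
apply/cvg_ex; exists ([ffun i => l i] : hsum).
apply/cvgrPdist_le => e e0.
have e1 : 0 < e / #|I|.+1%:R by rewrite divr_gt0.
have : \forall x \near F, forall i, `|l i - (x : {ffun I -> H}) i|
    <= e / #|I|.+1%:R.
  by apply: filter_forall => i; have /cvgrPdist_le/(_ _ e1) := lP i.
apply: filterS => x xP.
rewrite -(divfK (_ : #|I|.+1%:R != 0 :> R[i]) e) ?pnatr_eq0// mulrC.
apply: hsum_norm_le => [|i]; first exact: ltW.
by rewrite !ffunE.
Qed.

HB.instance Definition _ := Uniform_isComplete.Build hsum hsum_complete.

Definition hsum_hilbert : hilbertType R :=
  @HilbertType R hsum hsum_dot hsum_dot_norm.

Definition hcoord (x : hsum_hilbert) (i : I) : H := (x : {ffun I -> H}) i.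

Lemma inner_hsum (x y : hsum_hilbert) :
  inner hsum_hilbert x y = \sum_i inner H (hcoord x i) (hcoord y i).
Proof. by []. Qed.

Lemma nrm_hsum (x : hsum_hilbert) : nrm x ^+ 2 = \sum_i nrm (hcoord x i) ^+ 2.
Proof.
apply: complexI; rewrite -innerxx_nrm inner_hsum rmorph_sum.
by apply: eq_bigr => i _; rewrite innerxx_nrm.
Qed.

(** The isometry of the Naimark dilation will be such a column. The bound holds since the sum of the
    [c i ^+ 2] is at most the square of the sum of the [c i]. *)
Lemma column_exists (B : I -> 'B(H, H)) :
  exists V : 'B(H, hsum_hilbert), forall h i, hcoord (V h) i = B i h.
Proof.
have /choice[c cP] : forall i, exists c : R, 0 <= c /\ forall h, nrm (B i h)
    <= c * nrm h.
  by move=> i; have [c c0 cB] := bounded_nrm (B i); exists c.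
pose f (x : H) : hsum_hilbert := [ffun i => B i x] : hsum.
have lf : linear f.
  by move=> a u v; apply/ffunP => i; rewrite !ffunE linearP.
have fb (x : H) : nrm (f x) <= (\sum_i c i) * nrm x.
  have sc i : 0 <= c i := (cP i).1.
  rewrite -(@ler_pXn2r _ 2%N) ?nnegrE ?nrm_ge0 ?mulr_ge0 ?nrm_ge0 ?sumr_ge0//.
  rewrite nrm_hsum exprMn [X in _ <= X * _]expr2 !mulr_suml.
  apply: ler_sum => i _; rewrite /hcoord ffunE.
  apply: (@le_trans _ _ ((c i * nrm x) ^+ 2)).
    by rewrite ler_pXn2r ?nnegrE ?nrm_ge0 ?mulr_ge0 ?nrm_ge0//; exact: (cP i).2.
  rewrite exprMn ler_wpM2r ?sqr_ge0// expr2 ler_wpM2l//.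
  by rewrite (bigD1 i)//= lerDl sumr_ge0.
have [V VE] := bounded_op lf fb.
by exists V => x i; rewrite VE /hcoord ffunE.
Qed.

(** The dilating unitaries and their adjoints will be of this form. *)
Lemma diagonal_exists (z : I -> R[i]) (r : R) : 0 <= r ->
  (forall i, nrm (z i) <= r) ->
  exists D : 'B(hsum_hilbert, hsum_hilbert),
    (forall (x : hsum_hilbert) i, hcoord (D x) i = z i *: hcoord x i) /\
    (forall x : hsum_hilbert, nrm (D x) <= r * nrm x).
Proof.
move=> r0 zr.
pose f (x : hsum_hilbert) : hsum_hilbert :=
    [ffun i => z i *: hcoord x i] : hsum.
have lf : linear f.
  move=> a u v; apply/ffunP => i; rewrite !ffunE /hcoord !ffunE scalerDr
      !scalerA.
  by rewrite mulrC.
have fb (x : hsum_hilbert) : nrm (f x) <= r * nrm x.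
  rewrite -(@ler_pXn2r _ 2%N) ?nnegrE ?nrm_ge0 ?mulr_ge0 ?nrm_ge0//.
  rewrite exprMn !nrm_hsum mulr_sumr; apply: ler_sum => i _.
  rewrite -exprMn ler_pXn2r ?nnegrE ?nrm_ge0 ?mulr_ge0 ?nrm_ge0//.
  by rewrite {1}/hcoord ffunE nrmZ ler_wpM2r ?nrm_ge0.
have [D DE] := bounded_op lf fb; exists D; split => x; last by rewrite DE.
by move=> i; rewrite DE {1}/hcoord ffunE.
Qed.

End DirectSum.

(** * Normal operators whose spectrum lies in the disk *)

Section NormalNorm.
Context {R : realType}.
Implicit Types H : hilbertType R.

(** In characteristic 0 the polynomial ['X^n - 1] is separable, so it has [n] distinct roots, and
    among these one is primitive. *)
Lemma prim_root_exists n : (0 < n)%N -> exists w : R[i], n.-primitive_root w.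
Proof.
move=> n0; pose p : {poly R[i]} := 'X^n - 1.
have [r Dp] := closed_field_poly_normal p.
rewrite (monicP _) ?monicXnsubC // scale1r in Dp.
have rn1 : all n.-unity_root r by apply/allP=> z; rewrite -root_prod_XsubC -Dp.
have sz_r : (n < (size r).+1)%N.
  by rewrite -(size_prod_XsubC r id) -Dp size_XnsubC.
have Ur : uniq r.
  by rewrite -separable_prod_XsubC -Dp separable_Xn_sub_1 // pnatr_eq0 -lt0n.
by have [z _ zP] := hasP (has_prim_root n0 rn1 Ur sz_r); exists z.
Qed.

Lemma nrm_prim_root n (w : R[i]) : (0 < n)%N -> w ^+ n = 1 -> nrm w = 1.
Proof.
move=> n0 wn; apply/eqP; rewrite -(@pexpr_eq1 _ _ n) ?nrm_ge0//.
by rewrite -nrmX wn -(rmorph1 (real_complex R)) nrm_real normr1.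
Qed.

Lemma conj_mul_nrm1 (w : R[i]) : nrm w = 1 -> w * Num.conj w = 1.
Proof. by move=> w1; rewrite -normCK nrmE w1 expr1n. Qed.

Lemma sum_unity_root n (z : R[i]) : z ^+ n = 1 -> z != 1 ->
  \sum_(j < n) z ^+ j = 0.
Proof.
move=> zn z1; have : (z - 1) * (\sum_(j < n) z ^+ j) = 0.
  by rewrite -subrX1 zn subrr.
by move/eqP; rewrite mulf_eq0 subr_eq0 (negPf z1) => /eqP.
Qed.

(** These are the orthogonality relations of the characters of Z/n, the source of the Parseval
    identity below. *)
Lemma prim_root_orth n (w : R[i]) (k l : 'I_n) : n.-primitive_root w ->
  \sum_(j < n) (w ^+ j) ^+ k * Num.conj ((w ^+ j) ^+ l)
      = if k == l then n%:R else 0.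
Proof.
move=> wp; have n0 : (0 < n)%N by apply: leq_ltn_trans (ltn_ord k).
have wn := prim_expr_order wp.
have w1 j : nrm (w ^+ j) = 1 by rewrite nrmX (nrm_prim_root n0 wn) expr1n.
pose z := w ^+ k * Num.conj (w ^+ l).
have -> : \sum_(j < n) (w ^+ j) ^+ k * Num.conj ((w ^+ j) ^+ l)
    = \sum_(j < n) z ^+ j.
  by apply: eq_bigr => j _; rewrite /z exprMn -rmorphXn /= -!exprM !(mulnC j).
have [kl|kl] := eqVneq k l.
  rewrite /z kl conj_mul_nrm1// (eq_bigr (fun=> 1)) => [|j _];
      last by rewrite expr1n.
  by rewrite sumr_const card_ord.
apply: sum_unity_root.
  by rewrite /z exprMn -rmorphXn -!exprM !(mulnC _ n) !exprM wn !expr1n rmorph1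
      mulr1.
apply: contra kl => /eqP zk.
have : w ^+ k = w ^+ l.
  rewrite -[LHS]mulr1 -(conj_mul_nrm1 (w1 l)) mulrCA.
  by rewrite -/z zk mulr1.
by move/eqP; rewrite (eq_prim_root_expr wp) !modn_small.
Qed.

(** The left side is the inner product of [x] with [B (N x)], and a normal [N] and its adjoint [B]
    give vectors of equal norm. The inequality makes the norms along an orbit log-convex. *)
Lemma normal_nrm_sq H (N : 'B(H, H)) x : normal_operator N ->
  nrm (N x) ^+ 2 <= nrm x * nrm (N (N x)).
Proof.
move=> [B NB comm].
have NBc z : N (B z) = B (N z).
  by have /(congr1 (fun f : 'B(H, H) => f z)) := comm.
have nB z : nrm (B z) = nrm (N z).
  apply/eqP; rewrite -(@eqrXn2 _ 2%N) ?nrm_ge0//; apply/eqP/complexI.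
  rewrite -!innerxx_nrm -(NB (B z)) NBc NB.
  by rewrite [LHS]innerC -NB innerxx_nrm; apply/CrealP/complex_realP; eexists.
have -> : nrm (N x) ^+ 2 = nrm (inner H x (B (N x))).
  by rewrite -NB innerxx_nrm nrm_real ger0_norm ?sqr_ge0.
by apply: le_trans (inner_le _ _) _; rewrite nB.
Qed.

(* A vector [x] nearly attaining the norm of a normal [U] of norm 1 has an
   orbit [U^k x] of nearly constant norm. The Fourier sums
   [y_j = \sum_(k < n) w^(jk) U^k x] satisfy [w^j U y_j - y_j = U^n x - x], and
   Parseval forces one of them to have norm of order [sqrt n]. *)
Lemma approximate_eigenvalue H (N : 'B(H, H)) n : normal_operator N ->
  0 < opnorm N -> (0 < n)%N ->
  exists lam y, [/\ nrm lam = 1, 0 < nrm y &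
    n%:R * nrm (N y - ((opnorm N)%:C * lam) *: y) ^+ 2
        <= 8 * opnorm N ^+ 2 * nrm y ^+ 2].
Proof.
move=> Nn r0 n0; set r := opnorm N in r0 *.
pose U x := r^-1%:C *: N x.
have Ulin : linear U by move=> a u v; rewrite /U linearP; hilbert_ring.
have NU x : N x = r%:C *: U x.
  by rewrite /U scalerA -rmorphM divff ?gt_eqF// scale1r.
have nU x : nrm (U x) = r^-1 * nrm (N x).
  by rewrite nrmZ nrm_real ger0_norm// invr_ge0 ltW.
have U1 x : nrm (U x) <= nrm x.
  by rewrite nU ler_pdivrMl// nrm_opnorm.
have U2 x : nrm (U x) ^+ 2 <= nrm x * nrm (U (U x)).
  rewrite !nU /U linearZ nrmZ nrm_real ger0_norm; last by rewrite invr_ge0 ltW.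
  rewrite exprMn.
  have := normal_nrm_sq x Nn; rewrite -(ler_pM2l (_ : 0 < r^-1 * r^-1))
      ?mulr_gt0 ?invr_gt0//.
  lra.
(* By Bernoulli's inequality [q ^+ k >= 3 / 4] for [k <= n], and the square of [3 / 4] exceeds
   [1 / 2]. *)
pose q : R := 1 - (4 * n%:R)^-1.
have n1 : 1 <= n%:R :> R by rewrite ler1n.
have qn : 4 * n%:R * (1 - q) = 1 by rewrite /q opprB addrC subrK divff//
    mulf_neq0 ?pnatr_eq0 -?lt0n.
have q34 : 3 / 4 <= q by nra.
have [x xP] : exists x, q * nrm x < nrm (U x).
  apply: contrapT => nex.
  have : r <= q * r.
    apply: opnorm_le => [|x]; first by nra.
    have : nrm (U x) <= q * nrm x by rewrite leNgt; apply/negP => xq;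
        apply: nex; exists x.
    by rewrite nU -ler_pdivlMl ?invr_gt0// invrK mulrA [r * q]mulrC.
  nra.
pose u k := iter k U x.
have x0 : 0 < nrm x.
  rewrite lt_def nrm_ge0 andbT; apply/eqP => x0; move: xP (U1 x).
  by rewrite x0 mulr0 => /lt_le_trans h /h; rewrite ltxx.
(* By [U2] the ratios [nrm (u k.+1) / nrm (u k)] do not decrease, so the bound [q] at [k = 0]
   persists. *)
have uq k : q * nrm (u k) <= nrm (u k.+1) /\ 0 < nrm (u k).
  elim: k => [|k [IH1 IH2]]; first by split => //; exact: ltW.
  have u1 : 0 < nrm (u k.+1) by apply: lt_le_trans IH1; rewrite mulr_gt0//; lra.
  split => //; have := U2 (u k); rewrite -/(u k.+1) -/(u k.+2) => uu.
  rewrite -(ler_pM2l IH2); apply: le_trans uu; rewrite expr2 mulrCA mulrA.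
  by apply: ler_wpM2r => //; exact: ltW.
have qk k : 1 - k%:R * (1 - q) <= q ^+ k.
  elim: k => [|k IH]; first by rewrite mul0r subr0 expr0.
  rewrite exprS; apply: (@le_trans _ _ (q * (1 - k%:R * (1 - q)))).
    rewrite -[k.+1]addn1 natrD.
    have := mulr_ge0 (ler0n R k) (sqr_ge0 (1 - q)); lra.
  by apply: ler_wpM2l => //; lra.
have uk k : (k < n)%N -> nrm x ^+ 2 / 2 <= nrm (u k) ^+ 2.
  move=> kn; have uqk : q ^+ k * nrm x <= nrm (u k).
    elim: k {kn} => [|k IH]; first by rewrite expr0 mul1r.
    apply: le_trans (uq k).1; rewrite exprS -mulrA ler_wpM2l//; lra.
  have kn' : k%:R <= n%:R :> R by rewrite ler_nat ltnW.
  have : 3 / 4 <= q ^+ k by apply: le_trans (qk k); nra.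
  move=> h; have : 3 / 4 * nrm x <= nrm (u k).
    by apply: le_trans uqk; rewrite ler_wpM2r// ltW.
  by move=> h2; nra.
have [w wp] := prim_root_exists n0.
have wn := prim_expr_order wp.
have w1 j : nrm (w ^+ j) = 1 by rewrite nrmX (nrm_prim_root n0 wn) expr1n.
pose y (j : 'I_n) := \sum_(k < n) (w ^+ j) ^+ k *: u k.
have parseval : \sum_j nrm (y j) ^+ 2 = n%:R * \sum_(k < n) nrm (u k) ^+ 2.
  apply: complexI; rewrite rmorph_sum rmorphM rmorph_nat rmorph_sum /=
      mulr_sumr.
  transitivity (\sum_(j < n) \sum_(k < n) \sum_(l < n)
      ((w ^+ j) ^+ k * Num.conj ((w ^+ j) ^+ l)) * inner H (u k) (u l)).
    apply: eq_bigr => j _; rewrite -innerxx_nrm inner_suml;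
        apply: eq_bigr => k _.
    rewrite innerC inner_suml rmorph_sum; apply: eq_bigr => l _ /=.
    by rewrite -innerC innerZl innerZr mulrA.
  rewrite exchange_big /=; apply: eq_bigr => k _; rewrite exchange_big /=.
  rewrite (bigD1 k)//= [X in _ + X]big1 => [|l lk].
    by rewrite -mulr_suml (prim_root_orth k k wp) eqxx addr0 innerxx_nrm.
  by rewrite -mulr_suml (prim_root_orth k l wp) eq_sym (negPf lk) mul0r.
(* Pigeonhole: by Parseval and [uk] the [n] squared norms add up to at least
   [n ^ 2 * nrm x ^+ 2 / 2]. *)
have [j yj] : exists j, n%:R * (nrm x ^+ 2 / 2) <= nrm (y j) ^+ 2.
  apply: contrapT => nex.
  have : \sum_j nrm (y j) ^+ 2 < \sum_(j < n) n%:R * (nrm x ^+ 2 / 2).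
    apply: ltr_sum => [|j _]; first by apply/hasP; exists (Ordinal n0);
        rewrite ?mem_index_enum.
    by rewrite ltNge; apply/negP => ?; apply: nex; exists j.
  rewrite parseval sumr_const card_ord -[X in _ < X]mulr_natl ltr_pM2l ?ltr0n//.
  apply/negP; rewrite -leNgt mulr_natl -[in leLHS](card_ord n) -sumr_const.
  by apply: ler_sum => k _; exact: uk.
(* As [w ^+ j *: U (y j)] is close to [y j], the approximate eigenvalue of [U] is the inverse of
   [w ^+ j], its conjugate. *)
exists (Num.conj (w ^+ j)), (y j).
have nl : nrm (Num.conj (w ^+ j)) = 1 by rewrite -(w1 j) /nrm normcJ.
have yy : 0 < nrm (y j) ^+ 2 by apply: lt_le_trans yj;
    rewrite !mulr_gt0 ?invr_gt0 ?ltr0n ?exprn_gt0.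
split => //; first by rewrite lt_def nrm_ge0 andbT; apply: contraTneq yy => ->;
    rewrite expr0n ltxx.
have Uy : w ^+ j *: U (y j) - y j = u n - u 0%N.
  have Usum : U (y j) = \sum_(k < n) (w ^+ j) ^+ k *: u k.+1.
    rewrite /U /y linear_sum scaler_sumr; apply: eq_bigr => k _.
    by rewrite linearZ /= scalerA mulrC -scalerA.
  rewrite Usum scaler_sumr -sumrB.
  transitivity (\sum_(k < n) ((w ^+ j) ^+ k.+1 *: u k.+1
      - (w ^+ j) ^+ k *: u k)).
    by apply: eq_bigr => k _; rewrite scalerA -exprS.
  rewrite -(big_mkord xpredT (fun k =>
      (w ^+ j) ^+ k.+1 *: u k.+1 - (w ^+ j) ^+ k *: u k)).
  rewrite telescope_sumr// expr0 scale1r -exprM mulnC exprM wn expr1n scale1r//.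
have un k : nrm (u k) <= nrm x.
  by elim: k => [|k IH]; [exact: lexx|apply: le_trans IH; exact: U1].
have -> : N (y j) - (r%:C * Num.conj (w ^+ j)) *: y j =
    (r%:C * Num.conj (w ^+ j)) *: (w ^+ j *: U (y j) - y j).
  rewrite NU scalerBr (scalerA _ (w ^+ j)) -mulrA (mulrC (Num.conj _)).
  by rewrite conj_mul_nrm1 ?mulr1.
rewrite Uy nrmZ nrmM nrm_real (ger0_norm (ltW r0)) nl mulr1.
(* The constant 8 is this 4 times the 2 from [n * nrm x ^+ 2 <= 2 * nrm (y j) ^+ 2]. *)
have : nrm (u n - u 0%N) ^+ 2 <= 4 * nrm x ^+ 2.
  have := un n; have := nrmB (u n) (u 0%N); have := nrm_ge0 (u n - u 0%N);
      rewrite [u 0%N]/=; nra.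
move=> h; rewrite exprMn.
have := ler_wpM2l (_ : 0 <= r ^+ 2 * n%:R) h;
    rewrite mulr_ge0 ?sqr_ge0// => /(_ isT).
have := ler_wpM2l (_ : 0 <= r ^+ 2) yj; rewrite sqr_ge0// => /(_ isT).
lra.
Qed.

End NormalNorm.

(** * From approximate eigenvalues to the norm bound *)

Section NormalSpectrum.
Context {R : realType}.
Implicit Types H : hilbertType R.

Lemma nrm_ReIm (z : R[i]) : nrm z <= `|complex.Re z| + `|complex.Im z|.
Proof.
have {1}-> : z = (complex.Re z)%:C + 'i%C * (complex.Im z)%:C
    by exact: complexE.
apply: le_trans (nrmD _ _) _; rewrite nrmM !nrm_real.
suff -> : nrm ('i%C : R[i]) = 1 by rewrite mul1r.
by rewrite /nrm normc_def /= expr0n expr1n add0r sqrtr1.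
Qed.

Lemma Im_le_nrm (z : R[i]) : `|complex.Im z| <= nrm z.
Proof.
rewrite -(mul1r (nrm z)).
have <- : nrm ('i%C : R[i]) = 1.
  by rewrite /nrm normc_def /= expr0n expr1n add0r sqrtr1.
by rewrite -nrmM mulrC; apply: le_trans (Re_le_nrm _); rewrite ReiNIm normrN.
Qed.

(** Bolzano-Weierstrass, from compactness of the square containing the disk. The lower bound [k] on
    the index leaves room for a second condition on large [n]. *)
Lemma bounded_cluster (z : nat -> R[i]) : (forall n, nrm (z n) <= 1) ->
  exists l, forall e k, 0 < e -> exists2 n, (k <= n)%N & nrm (l - z n) < e.
Proof.
move=> z1.
pose v n : R * R := (complex.Re (z n), complex.Im (z n)).
pose A : set (R * R) := `[-1, 1]%classic `*` `[-1, 1]%classic.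
have cA : compact A by apply: compact_setX; exact: segment_compact.
have FA : (v n @[n --> \oo]) A.
  exists 0%N => // n _; split; rewrite /= in_itv /= -ler_norml.
    exact: le_trans (Re_le_nrm _) (z1 n).
  exact: le_trans (Im_le_nrm _) (z1 n).
have [[a b] [_ cl]] := cA _ _ FA.
exists (a +i* b) => e k e0.
have e2 : 0 < e / 2 by rewrite divr_gt0.
have Fk : (v n @[n --> \oo]) (v @` [set n | (k <= n)%N]).
  by exists k => // n kn; exists n.
have Bab : nbhs (a, b) (ball a (e / 2) `*` ball b (e / 2)).
  by exists (ball a (e / 2), ball b (e / 2)) => //; split; exact: nbhsx_ballx.
have [_ [[n /= kn <-] [/= va vb]]] := cl _ _ Fk Bab.
exists n => //; apply: le_lt_trans (nrm_ReIm _) _.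
move: va vb; rewrite -!ball_normE /=.
by case: (z n) => [c d] /=; lra.
Qed.

(** If [r = opnorm N] exceeded 1, the approximate eigenvalues [r * lam n] would cluster at some
    [r * l] of modulus greater than 1, where [N - r l] could not be bounded below. *)
Lemma bounded_below_contraction H (N : 'B(H, H)) : normal_operator N ->
  (forall lam : R[i], 1 < nrm lam ->
    exists2 c : R, 0 < c & forall x, c * nrm x <= nrm (N x - lam *: x)) ->
  forall x, nrm (N x) <= nrm x.
Proof.
move=> Nn bb x.
suff r1 : opnorm N <= 1.
  by apply: le_trans (nrm_opnorm _ _) _; rewrite ler_piMl// nrm_ge0.
rewrite leNgt; apply/negP => r1; set r := opnorm N in r1.
have r0 : 0 < r by exact: lt_trans r1.
have /choice[lam lamP] n := approximate_eigenvalue Nn r0 (ltn0Sn n).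
have [l lP] : exists l, forall e k, 0 < e ->
    exists2 n, (k <= n)%N & nrm (l - lam n) < e.
  by apply: bounded_cluster => n; have [y [-> _ _]] := lamP n.
have l1 : 1 <= nrm l.
  apply/ler_addgt0Pr => e e0; have [n _ ln] := lP e 0%N e0.
  have [y [<- _ _]] := lamP n.
  have -> : lam n = l - (l - lam n) by rewrite opprB addrC subrK.
  by apply: le_trans (nrmB _ _) _; rewrite lerD2l ltW.
have [|c c0 cP] := bb (r%:C * l).
  by rewrite nrmM nrm_real gtr0_norm//; apply: lt_le_trans r1 _;
      rewrite ler_pMr.
(* Replacing [r * lam n] by [r * l] then costs at most half of [c]; [k] is such that the eigenvalue
   defect [8 * r ^+ 2 / n.+1] falls below [(c / 2) ^+ 2]. *)
pose e := c / (2 * r).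
have e0 : 0 < e by rewrite divr_gt0// mulr_gt0.
pose k := Num.truncn (32 * r ^+ 2 / c ^+ 2).
have [n kn ln] := lP e k e0.
have [y [_ y0 yP]] := lamP n.
have n_big : 32 * r ^+ 2 < c ^+ 2 * n.+1%:R.
  rewrite (mulrC (c ^+ 2)) -ltr_pdivrMr ?exprn_gt0//.
  have := truncnS_gt (32 * r ^+ 2 / c ^+ 2); rewrite -/k => /lt_le_trans; apply.
  by rewrite ler_nat.
have := cP y.
have -> : N y - (r%:C * l) *: y = (N y - (r%:C * lam n) *: y)
    - (r%:C * (l - lam n)) *: y.
  hilbert_ring.
move=> h; have := le_trans h (nrmB _ _);
    rewrite nrmZ nrmM nrm_real gtr0_norm// => {}h.
have re : r * e = c / 2 by rewrite /e; field; rewrite gt_eqF.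
have h2 : r * nrm (l - lam n) * nrm y <= c / 2 * nrm y.
  by apply: ler_wpM2r; [exact: ltW|rewrite -re ler_pM2l// ltW].
have h3 : c / 2 * nrm y <= nrm (N y - (r%:C * lam n) *: y) by lra.
have h4 : (c / 2 * nrm y) ^+ 2 <= nrm (N y - (r%:C * lam n) *: y) ^+ 2.
  rewrite ler_pXn2r// nnegrE ?nrm_ge0//; apply: mulr_ge0; [lra|exact: ltW].
have h5 : n.+1%:R * (c / 2 * nrm y) ^+ 2 <= 8 * r ^+ 2 * nrm y ^+ 2.
  by apply: le_trans yP; apply: ler_wpM2l.
have y2 : 0 < nrm y ^+ 2 by rewrite exprn_gt0.
have : 32 * r ^+ 2 * nrm y ^+ 2 < c ^+ 2 * n.+1%:R * nrm y ^+ 2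
    by rewrite ltr_pM2r.
lra.
Qed.

(** A [lam] outside the disk is not in the spectrum, which provides a bounded left inverse of
    [N 0 - lam]; this bounds [N 0 - lam] from below. *)
Lemma spectrum_contraction H (N : 'I_1 -> 'B(H, H)) : normal_tuple N ->
  joint_spectrum N `<=` @closed_polydisk R 1 ->
  forall x, nrm (N 0 x) <= nrm x.
Proof.
move=> [Nn _] sN; apply: bounded_below_contraction => // lam lam1.
have : ~ joint_spectrum N (fun=> lam).
  move=> /sN /(_ 0); rewrite nrmE -(rmorph1 (real_complex R)) lecR.
  by rewrite leNgt lam1.
move=> /contrapT[B _ BP].
have [c c0 cP] := bounded_nrm (B 0).
(* The bound [c] may be 0, so [c + 1] is inverted. *)
have c1 : 0 < c + 1 by rewrite ltr_wpDl.
exists (c + 1)^-1 => [|x]; first by rewrite invr_gt0.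
rewrite ler_pdivrMl//; have := BP x; rewrite big_ord1 => {1}<-.
apply: le_trans (cP _) _; rewrite ler_wpM2r ?nrm_ge0// lerDl//.
Qed.

End NormalSpectrum.

(** * The unitary dilation *)

Section Dilation.
Context {R : realType}.
Implicit Types H L : hilbertType R.

Lemma hsum_ext H (I : finType) (x y : hsum_hilbert H I) :
  (forall i, hcoord x i = hcoord y i) -> x = y.
Proof. by move=> xy; apply/ffunP => i; exact: xy. Qed.

Lemma op_sum_exists H L (I : finType) (a : I -> R[i]) (A : I -> 'B(H, L)) :
  exists B : 'B(H, L), forall x, B x = \sum_i a i *: A i x.
Proof.
have /choice[c cP] : forall i, exists c : R, 0 <= c /\ forall x, nrm (A i x)
    <= c * nrm x.
  by move=> i; have [c c0 cB] := bounded_nrm (A i); exists c.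
have lf : linear (fun x => \sum_i a i *: A i x).
  move=> b u v; rewrite scaler_sumr -big_split; apply: eq_bigr => i _.
  by rewrite linearP scalerDr !scalerA mulrC.
have [x|B BE] := @bounded_op _ _ _ _ (\sum_i nrm (a i) * c i) lf;
    last by exists B.
apply: le_trans (nrm_sum _) _; rewrite mulr_suml; apply: ler_sum => i _.
by rewrite nrmZ -mulrA ler_wpM2l ?nrm_ge0 ?(cP i).2.
Qed.

Lemma sum_prim_root n (w : R[i]) m : n.-primitive_root w ->
  \sum_(k < n) (w ^+ k) ^+ m = if (n %| m)%N then n%:R else 0.
Proof.
move=> wp; have wn := prim_expr_order wp.
rewrite (eq_bigr (fun k : 'I_n => (w ^+ m) ^+ k)) => [|k _];
    last by rewrite -!exprM mulnC.
rewrite (prim_order_dvd wp); case: eqP => [->|/eqP wm].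
  by rewrite (eq_bigr (fun=> 1)) => [|k _];
      rewrite ?expr1n// sumr_const card_ord.
by apply: sum_unity_root => //; rewrite -exprM mulnC exprM wn expr1n.
Qed.

Lemma conj_unity_root n (z : R[i]) m : (0 < n)%N -> z ^+ n = 1 -> (m <= n)%N ->
  Num.conj (z ^+ m) = z ^+ (n - m).
Proof.
move=> n0 zn mn; have zm : z ^+ m * Num.conj (z ^+ m) = 1.
  by rewrite conj_mul_nrm1// nrmX (nrm_prim_root n0 zn) expr1n.
by rewrite -[LHS]mul1r -zn -(subnK mn) exprD -mulrA zm mulr1 subnK.
Qed.

Lemma conj_realC (a : R) : Num.conj (a%:C) = a%:C :> R[i].
Proof. by apply/CrealP/complex_realP; exists a. Qed.

(* The exponents [2i+1] and [4d-(2i+1)], attached to [T_i^*] and [T_i]. *)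
Definition odd_exponent d (a : 'I_d * bool) : nat :=
  if a.2 then (a.1.*2).+1 else (4 * d - (a.1.*2).+1)%N.

(** This exchanges the labels of [T_i] and its adjoint; on exponents it is negation modulo
    [4 * d]. *)
Definition flip d (a : 'I_d * bool) := (a.1, ~~ a.2).

Lemma flipK d : involutive (@flip d).
Proof. by case=> i b; rewrite /flip negbK. Qed.

Lemma odd_exponent_lt d (a : 'I_d * bool) : (odd_exponent a < 4 * d)%N.
Proof. by case: a => i [] /=; rewrite /odd_exponent /=; have := ltn_ord i;
    lia. Qed.

Lemma odd_exponent_flip d (a : 'I_d * bool) :
  odd_exponent (flip a) = (4 * d - odd_exponent a)%N.
Proof. by case: a => i [] /=; rewrite /odd_exponent /=; have := ltn_ord i;
    lia. Qed.

Lemma odd_exponentP d (a : 'I_d * bool) : odd (odd_exponent a).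
Proof.
case: a => i [] /=; rewrite /odd_exponent /= ?odd_double//.
have := ltn_ord i; lia.
Qed.

Lemma dvdn_quadruple_odd d (a : nat) : odd a -> (4 * d %| a)%N = false.
Proof.
move=> oa; apply/negP => /dvdnP[k kE]; move: oa.
by rewrite kE !oddM andbF.
Qed.

(** The sum lies strictly between 0 and [8 * d], so it would have to equal [4 * d]. Two exponents
    below [2 * d] add up to less, two above to more, and a mixed pair gives [4 * d] only for equal
    indices. *)
Lemma dvdn_odd_exponentD d (a b : 'I_d * bool) :
  (4 * d %| odd_exponent a + odd_exponent b)%N = (b == flip a).
Proof.
apply/idP/eqP => [|->]; last first.
  by rewrite odd_exponent_flip subnKC// ltnW// odd_exponent_lt.
move=> /dvdnP[k]; case: a b => i a [j b]; have := ltn_ord i; have := ltn_ord j.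
rewrite /odd_exponent /flip; move=> jd id.
case: k => [|[|k]]; rewrite ?mulSn ?mul0n ?addn0.
- by case: a b => [] [] /=; lia.
- by case: a b => [] [] /= kE; try lia; congr (_, _); apply: val_inj => /=; lia.
- by set t := (k * _)%N; case: a b => [] [] /=; lia.
Qed.

End Dilation.

(** * Construction of the dilating unitaries *)

Section UnitaryDilation.
Context {R : realType}.
Implicit Types H L : hilbertType R.

(** The period [4 * d] is recorded because it locates the joint spectrum. *)
Lemma unitary_dilation d H (T : 'I_d -> 'B(H, H)) : (0 < d)%N ->
  (forall i x, nrm (T i x) <= nrm x) ->
  exists (L : hilbertType R) (U : 'I_d -> 'B(L, L)) (V : 'B(H, L))
      (W : 'B(L, H)),
    [/\ isometric V, is_adjoint V W, normal_tuple U,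
      forall i x, nrm (U i x) <= nrm x &
      (forall i x, iter (4 * d) (U i) x = x) /\
      (forall i x, W (U i (V x)) = (Num.sqrt (2 * d)%:R)^-1%:C *: T i x)].
Proof.
move=> d0 T1; set c := (Num.sqrt (2 * d)%:R)^-1.
have d2 : 0 < (2 * d)%:R :> R by rewrite ltr0n muln_gt0.
have c0 : 0 <= c by rewrite invr_ge0 sqrtr_ge0.
have cc : c ^+ 2 * (2 * d)%:R = 1.
  by rewrite exprVn sqr_sqrtr ?mulVf ?gt_eqF// ltW.
pose I : finType := ('I_d * bool)%type.
pose M := (4 * d)%N; have M0 : (0 < M)%N by rewrite muln_gt0.
have [w wp] := @prim_root_exists R M M0; have wM := prim_expr_order wp.
have wkM k : (w ^+ k) ^+ M = 1 by rewrite -exprM mulnC exprM wM expr1n.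
have w1 k m : nrm ((w ^+ k) ^+ m) = 1
    by rewrite !nrmX (nrm_prim_root M0 wM) !expr1n.
have /choice[Ts TTs] := fun i => adjoint_exists (T i).
pose A (a : I) : 'B(H, H) := if a.2 then Ts a.1 else T a.1.
have Aadj a : is_adjoint (A a) (A (flip a)).
  case: a => i [] /= x y; rewrite /A /=; last exact: TTs.
  by rewrite innerC -TTs -innerC.
have A1 a x : nrm (A a x) <= nrm x.
  case: a => i []; rewrite /A /=; last exact: T1.
  rewrite -[leRHS]mul1r.
  by apply: (adjoint_bound ler01 (TTs i)) => y; rewrite mul1r.
(* [Q] has [2 * d] terms of norm at most [c ^+ 2 = 1 / (2 * d)], hence is a contraction, and the
   defect [1 - Q] has a square root [S]. *)
have [Q QE] := op_sum_exists (fun a : I => (c ^+ 2)%:C)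
    (fun a => bcomp (A a) (A (flip a))).
have Qadj : is_adjoint Q Q.
  move=> x y; rewrite !QE inner_suml [RHS]innerC inner_suml rmorph_sum.
  apply: eq_bigr => a _ /=; rewrite -innerC innerZl innerZr conj_realC.
  by rewrite Aadj Aadj flipK.
have Q1 x : nrm (Q x) <= nrm x.
  rewrite QE; apply: le_trans (nrm_sum _) _.
  apply: (@le_trans _ _ (\sum_(a : I) c ^+ 2 * nrm x)).
    apply: ler_sum => a _; rewrite nrmZ nrm_real ger0_norm ?sqr_ge0//.
    by apply: ler_wpM2l; [exact: sqr_ge0|exact: le_trans (A1 _ _) (A1 _ _)].
  rewrite sumr_const card_prod card_ord card_bool -mulr_natl mulrA
      [(d * 2)%N]mulnC.
  by rewrite [_%:R * _]mulrC cc mul1r.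
have [S Sadj SS] := sqrt_exists Qadj Q1.
have /choice[B0 B0E] := fun k : 'I_M =>
  op_sum_exists (fun a : I => c%:C * (w ^+ k) ^+ odd_exponent a) A.
pose B k := badd (bid H) (B0 k).
have BE k x : B k x = x + \sum_a (c%:C * (w ^+ k) ^+ odd_exponent a) *: A a x.
  by rewrite /= B0E.
(* Taking adjoints conjugates the root of unity and passes from [A a] to [A (flip a)], so it only
   permutes the terms. *)
have Badj k : is_adjoint (B k) (B k).
  move=> x y; rewrite !BE innerDl innerDr; congr (_ + _).
  rewrite inner_suml [RHS]innerC inner_suml rmorph_sum /=.
  rewrite (reindex_inj (inv_inj (@flipK d))); apply: eq_bigr => a _ /=.
  rewrite -innerC innerZl innerZr rmorphM /= conj_realC Aadj flipK.
  by rewrite odd_exponent_flip (conj_unity_root M0 (wkM k)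
      (ltnW (odd_exponent_lt a))).
(* The average of the squares of the [B k] is [1 + Q]; with [1 - Q] from [S] this makes 2, so the
   sum over [M] indices is normalised by [2 * M]. *)
pose t : R := Num.sqrt (2 * M%:R)^-1.
have t0 : 0 <= t by exact: sqrtr_ge0.
have tt : t ^+ 2 * (2 * M%:R) = 1.
  rewrite sqr_sqrtr; first by rewrite mulVf// mulf_neq0// pnatr_eq0 -lt0n.
  by rewrite invr_ge0 mulr_ge0.
have ttC : (t ^+ 2)%:C * (2 * M%:R) = 1 :> R[i].
  transitivity (t ^+ 2 * (2 * M%:R))%:C; last by rewrite tt.
  by rewrite !rmorphM !rmorph_nat.
(* Each [k] gets two rows, [B k] and [S], instead of one row with a square root of [B_k^2 + S^2]. *)
pose J : finType := ('I_M * bool)%type.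
have [V VE] := column_exists (fun p : J =>
    bscale t%:C (if p.2 then B p.1 else S)).
have [W VW] := adjoint_exists V.
pose L := hsum_hilbert H J.
pose z (i : 'I_d) (p : J) := (w ^+ p.1) ^+ odd_exponent (i, true).
have z1 i p : nrm (z i p) <= 1 by rewrite w1.
have /choice[U UP] := fun i => @diagonal_exists R H J (z i) 1 ler01 (z1 i).
have UE i (x : L) p : hcoord (U i x) p = z i p *: hcoord x p by exact: (UP i).1.
have U1 i x : nrm (U i x) <= nrm x by have := (UP i).2 x; rewrite mul1r.
pose delta m : R[i] := \sum_(k < M) (w ^+ k) ^+ m.
have deltaE m : delta m = if (M %| m)%N then M%:R else 0
    by exact: sum_prim_root.
have BB k x y : inner H (B k x) (B k y) = inner H x y +
    2 * c%:C * (\sum_a (w ^+ k) ^+ odd_exponent a * inner H (A a x) y) +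
    (c ^+ 2)%:C * (\sum_a \sum_b (w ^+ k) ^+ (odd_exponent a + odd_exponent b)%N *
      inner H (A a (A b x)) y).
  rewrite -Badj [B k (B k x)]BE innerDl inner_suml.
  have innerB v : inner H (B k x) v = inner H x v +
      c%:C * \sum_a (w ^+ k) ^+ odd_exponent a * inner H (A a x) v.
    rewrite BE innerDl inner_suml mulr_sumr; congr (_ + _).
    by apply: eq_bigr => a _; rewrite innerZl mulrA.
  rewrite innerB [X in _ + X = _](_ : _ = c%:C *
      (\sum_a (w ^+ k) ^+ odd_exponent a * inner H (A a x) y) +
    (c ^+ 2)%:C * (\sum_a \sum_b (w ^+ k) ^+ (odd_exponent a + odd_exponent b)%N *
      inner H (A a (A b x)) y)); first by ring.
  rewrite !mulr_sumr -big_split; apply: eq_bigr => a _ /=.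
  have -> : inner H ((c%:C * (w ^+ k) ^+ odd_exponent a) *: A a (B k x)) y =
      c%:C * (w ^+ k) ^+ odd_exponent a * inner H (B k x) (A (flip a) y).
    by rewrite innerZl Aadj.
  rewrite innerB -Aadj mulrDr mulrA; congr (_ + _); first by rewrite mulrA.
  rewrite !mulr_sumr; apply: eq_bigr => b _.
  by rewrite -Aadj exprD rmorphXn /=; ring.
have SSi x y : inner H (S x) (S y) =
    inner H x y - (c ^+ 2)%:C * \sum_a inner H (A a (A (flip a) x)) y.
  rewrite -Sadj SS innerBl QE inner_suml mulr_sumr; congr (_ - _).
  by apply: eq_bigr => a _; rewrite innerZl.
(* This computes the [m]-th moment of the operator valued measure: [m = 0] will show that [V] is
   isometric, and [m = 2i + 1] will give the compression of [U i]. *)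
have innerV (x y : H) (u : J -> R[i]) (m : nat)
    : (forall p, u p = (w ^+ p.1) ^+ m) ->
  \sum_p u p * inner H (hcoord (V x) p) (hcoord (V y) p) =
  (t ^+ 2)%:C * (2 * inner H x y * delta m +
     2 * c%:C * (\sum_a delta (m + odd_exponent a)%N * inner H (A a x) y) +
     (c ^+ 2)%:C * ((\sum_a \sum_b delta
         (m + (odd_exponent a + odd_exponent b))%N *
        inner H (A a (A b x)) y) - (\sum_a inner H (A a (A (flip a) x)) y)
            * delta m)).
  move=> uE.
  transitivity (\sum_(k < M) \sum_(b : bool) u (k, b) *
      inner H (hcoord (V x) (k, b)) (hcoord (V y) (k, b))).
    by rewrite pair_bigA; apply: eq_bigr => -[].
  transitivity (\sum_(k < M) (t ^+ 2)%:C * ((w ^+ k) ^+ m * (2 * inner H x y +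
     2 * c%:C * (\sum_a (w ^+ k) ^+ odd_exponent a * inner H (A a x) y) +
     (c ^+ 2)%:C * ((\sum_a \sum_b (w ^+ k) ^+
         (odd_exponent a + odd_exponent b)%N *
        inner H (A a (A b x)) y) - \sum_a inner H (A a (A (flip a) x)) y)))).
    apply: eq_bigr => k _; rewrite big_bool /= !uE !VE /= !innerZl !innerZr
        conj_realC.
    by rewrite -/(B k) BB SSi rmorphXn /=; ring.
  rewrite -mulr_sumr; congr (_ * _).
  have sumM (I' : finType) (e : I' -> nat) (p : I' -> R[i]) :
      \sum_(k < M) (w ^+ k) ^+ m * \sum_a (w ^+ k) ^+ e a * p a =
      \sum_a delta (m + e a)%N * p a.
    under eq_bigr do rewrite mulr_sumr.
    rewrite exchange_big; apply: eq_bigr => a _; rewrite mulr_suml.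
    by apply: eq_bigr => k _; rewrite exprD mulrA.
  have lin (Z F G : 'I_M -> R[i]) p f g q :
      \sum_k Z k * (p + f * F k + g * (G k - q)) = p * (\sum_k Z k) +
      f * (\sum_k Z k * F k) + g * ((\sum_k Z k * G k) - q * \sum_k Z k).
    rewrite mulrBr !mulr_sumr -sumrB -!big_split.
    by apply: eq_bigr => k _ /=; ring.
  rewrite (lin (fun k => (w ^+ k) ^+ m)); congr (_ + _ * _ + _ * (_ - _)).
    exact: sumM.
  under eq_bigr do rewrite pair_bigA.
  by rewrite sumM pair_bigA.
exists L, U, V, W; split => //.
(* At [m = 0] the linear terms have odd frequency and vanish; the quadratic ones survive only for
   [b = flip a] and cancel against the contribution of [S]. *)
- move=> x; rewrite !nrmE; congr (_%:C); apply/eqP.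
  rewrite -(@eqrXn2 _ 2%N) ?nrm_ge0//; apply/eqP/complexI;
      rewrite -!innerxx_nrm.
  rewrite inner_hsum; under eq_bigr do rewrite -[inner _ _ _]mul1r.
  rewrite (innerV x x (fun=> 1) 0%N)//.
  rewrite [X in _ + _ * X + _]big1 => [|a _]; last first.
    by rewrite deltaE dvdn_quadruple_odd ?odd_exponentP// mul0r.
  have -> : \sum_a \sum_b delta (0 + (odd_exponent a + odd_exponent b))%N *
      inner H (A a (A b x)) x = (\sum_a inner H (A a (A (flip a) x)) x) * M%:R.
    rewrite mulr_suml; apply: eq_bigr => a _; rewrite (bigD1 (flip a)) //=.
    rewrite add0n deltaE dvdn_odd_exponentD eqxx big1 => [|b bf]; last first.
      by rewrite add0n deltaE dvdn_odd_exponentD (negPf bf) mul0r.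
    by rewrite addr0 mulrC.
  rewrite deltaE dvdn0 subrr !mulr0 !addr0 mulrAC mulrA.
  by rewrite ttC mul1r.
- split => [i|i j].
    have zc1 p : nrm (Num.conj (z i p)) <= 1 by rewrite /nrm normcJ; exact: z1.
    have [D [DE _]] := diagonal_exists H ler01 zc1.
    exists D.
      by move=> x y; rewrite !inner_hsum; apply: eq_bigr => p _;
        rewrite UE DE innerZl innerZr conjCK.
    by apply: bounded_operator_ext => x; apply: hsum_ext => p /=;
      rewrite UE !DE UE !scalerA mulrC.
  by apply: bounded_operator_ext => x; apply: hsum_ext => p /=;
    rewrite !UE !scalerA mulrC.
split => i x.
  apply: hsum_ext => p.
  have itE n : hcoord (iter n (U i) x) p = z i p ^+ n *: hcoord x p.
    by elim: n => [|n IH]; rewrite ?expr0 ?scale1r// iterS UE IH scalerA -exprS.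
  by rewrite itE -exprM mulnC exprM wkM expr1n scale1r.
(* At [m = 2i + 1] the constant and quadratic terms have odd frequency and vanish; of the linear
   ones only [T i] remains, with coefficient [t ^+ 2 * 2 * c * M = c]. *)
apply: inner_ext => y; rewrite innerC -VW -innerC inner_hsum.
under eq_bigr do rewrite UE innerZl.
rewrite (innerV x y (z i) (odd_exponent (i, true)))//.
rewrite deltaE dvdn_quadruple_odd ?odd_exponentP// !mulr0 add0r subr0.
rewrite [X in _ + _ * X]big1 => [|a _]; last first.
  rewrite big1 // => b _.
  by rewrite deltaE dvdn_quadruple_odd ?mul0r// !oddD !odd_exponentP.
rewrite mulr0 addr0 (bigD1 (flip (i, true)))//= big1 ?addr0 => [|a af];
    last first.
  by rewrite deltaE dvdn_odd_exponentD (negPf af) mul0r.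
rewrite deltaE dvdn_odd_exponentD eqxx innerZl /A /=.
have -> : (t ^+ 2)%:C * (2 * c%:C * (M%:R * inner H (T i x) y)) =
    (t ^+ 2)%:C * (2 * M%:R) * (c%:C * inner H (T i x) y) by ring.
by rewrite ttC mul1r.
Qed.

End UnitaryDilation.

(** * The joint spectrum of the dilation *)

Section PolydiskSpectrum.
Context {R : realType}.
Implicit Types H L : hilbertType R.

Lemma normal_bscale H (c : R[i]) (A : 'B(H, H)) :
  normal_operator A -> normal_operator (bscale c A).
Proof.
move=> [B AB comm]; exists (bscale (Num.conj c) B).
  by move=> x y /=; rewrite innerZl innerZr conjCK AB.
apply: bounded_operator_ext => x /=; rewrite [A (_ *: _)]linearZ
    [B (_ *: _)]linearZ /= !scalerA mulrC.
by congr (_ *: _); exact: (congr1 (fun f : 'B(H, H) => f x) comm).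
Qed.

Lemma dilation_contraction H L (A : 'B(L, L)) (V : 'B(H, L)) (W : 'B(L, H)) :
  isometric V -> is_adjoint V W -> (forall y, nrm (A y) <= nrm y) ->
  forall x, nrm (W (A (V x))) <= nrm x.
Proof.
move=> Viso VW A1 x.
have V1 z : nrm (V z) = nrm z by rewrite /nrm Viso.
have W1 y : nrm (W y) <= nrm y.
  rewrite -[leRHS]mul1r.
  by apply: (adjoint_bound ler01 VW) => z; rewrite mul1r V1.
by apply: le_trans (W1 _) _; apply: le_trans (A1 _) _; rewrite V1.
Qed.

(* [lam^n - U^n] is divisible by [lam - U] and is here the scalar [lam^n - 1],
   so that the inverse of [U - lam] is a polynomial in [U]. *)
Lemma spectrum_root_of_unity d n H (U : 'I_d -> 'B(H, H)) : (0 < n)%N ->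
  (forall i x, iter n (U i) x = x) ->
      joint_spectrum U `<=` @closed_polydisk R d.
Proof.
move=> n0 Un lam slam i; rewrite nrmE -(rmorph1 (real_complex R)) lecR leNgt.
apply/negP => lam1; apply: slam.
pose P k := iter k (bcomp (U i)) (bid H).
(* [Q k] is the sum of [lam^(k-1-j) U^j] over [j < k], the quotient of [U^k - lam^k] by [U - lam].
   The zero operator is written as a multiple of [bid H], which keeps it visibly in the algebra. *)
pose Q := fix Q k := if k is k'.+1 then badd (bscale (lam i) (Q k')) (P k')
                     else bscale 0 (bid H).
have PE k x : P k x = iter k (U i) x by elim: k x => //= k IH x; rewrite IH.
have PB k x : P k (U i x - lam i *: x) = P k.+1 x - lam i *: P k x.
  by rewrite linearB linearZ !PE iterSr.
have QE k x : Q k (U i x - lam i *: x) = P k x - lam i ^+ k *: x.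
  elim: k => [|k IH]; first by rewrite /= scale0r expr0 scale1r subrr.
  rewrite -[LHS]/(lam i *: Q k (U i x - lam i *: x) + P k (U i x - lam i *: x)).
  by rewrite IH PB exprS; hilbert_ring.
have lamn : 1 - lam i ^+ n != 0.
  rewrite subr_eq0; apply/eqP => lamn.
  have : nrm (lam i) ^+ n = 1 by rewrite -nrmX -lamn -(rmorph1 (real_complex R))
      nrm_real normr1.
  by move/eqP; rewrite pexpr_eq1 ?nrm_ge0// => /eqP lam_1;
      rewrite lam_1 ltxx in lam1.
(* One coordinate outside the disk suffices to make the ideal improper, so all other coefficients
   are zero. *)
exists (fun j => if j == i then bscale (1 - lam i ^+ n)^-1 (Q n) else bscale 0
    (bid H)).
  move=> j S [[Sid Sadd Sscale Scomp _ _] US]; case: eqP => [_|_];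
      last exact: Sscale.
  apply: (Sscale).
  have SP k : S (P k).
    by elim: k => [//|k IH]; apply: Scomp => //; apply: US; exists i.
  by elim: n {n0 Un lamn} => [|k IH];
      [exact: Sscale|apply: Sadd => //; exact: Sscale].
move=> x; rewrite (bigD1 i)//= eqxx big1 => [|j /negPf ->]; last first.
  by rewrite /= scale0r.
rewrite addr0 /= QE PE Un.
have -> : x - lam i ^+ n *: x = (1 - lam i ^+ n) *: x
    by rewrite scalerBl scale1r.
by rewrite scalerA mulVf// scale1r.
Qed.

End PolydiskSpectrum.

(** * Rescaled dilations and the inclusion of matrix convex sets *)

Theorem theorem4p4 (R : realType) (d : nat) (d_gt0 : (0 < d)%N) :
  (forall (H : hilbertType R) (T : 'I_d -> 'B(H, H)),
     (forall i, opnorm (T i) <= 1) ->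
     exists (L : hilbertType R) (N : 'I_d -> 'B(L, L)),
       [/\ normal_tuple N, is_dilation N T &
           forall i, opnorm (N i) <= Num.sqrt (2 * d)%:R]) /\
  universe_subset
    (graded_product (fun _ : 'I_d => Wmin (@closed_polydisk R 1)))
    (universe_scale (Num.sqrt (2 * d)%:R) (Wmin (@closed_polydisk R d))).
Proof.
set s : R := Num.sqrt (2 * d)%:R.
have s0 : 0 < s by rewrite sqrtr_gt0 ltr0n muln_gt0.
have ss : s%:C * s^-1%:C = 1 by rewrite -rmorphM divff ?gt_eqF.
split => [H T T1|n X XW].
  have nT i x : nrm (T i x) <= nrm x.
    apply: le_trans (nrm_opnorm _ _) _.
    by rewrite -[leRHS]mul1r; apply: ler_wpM2r; [exact: nrm_ge0|exact: T1].
  have [L [U [V [W [Viso VW [Un Uc] U1 [_ UT]]]]]] := unitary_dilation d_gt0 nT.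
  (* [U] dilates [s^-1 T]; multiplication by [s] restores [T] and brings the norms up to at most
     [s]. *)
  exists L, (fun i => bscale s%:C (U i)); split.
  - split => [i|i j]; first exact: normal_bscale.
    apply: bounded_operator_ext => x /=;
        rewrite [U i (_ *: _)]linearZ [U j (_ *: _)]linearZ /=.
    by congr (_ *: (_ *: _)); exact: (congr1 (fun f : 'B(L, L) => f x)
        (Uc i j)).
  - exists V, W; split => // i; apply: bounded_operator_ext => x /=.
    by rewrite linearZ /= UT scalerA ss scale1r.
  - move=> i; apply: opnorm_le => [|x]; first exact: ltW.
    by rewrite nrmZ nrm_real gtr0_norm// ler_pM2l.
(* Each [X i] is a compression of a normal operator with spectrum in the disk, which is a
   contraction. *)
have nX i x : nrm (matrix_operator (X i) x) <= nrm x.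
  have [L [N [Nn sN [V [W [Viso VW XE]]]]]] := XW i.
  rewrite (XE 0); apply: (@dilation_contraction _ _ _ _ V) => //.
  exact: spectrum_contraction.
have [L [U [V [W [Viso VW Un U1 [Ur UT]]]]]] := unitary_dilation d_gt0 nX.
exists (fun i => s^-1%:C *: X i); last first.
  by apply/funext => i; rewrite scalerA ss scale1r.
exists L, U; split => //.
  by apply: spectrum_root_of_unity Ur; rewrite muln_gt0.
exists V, W; split => // i; apply: bounded_operator_ext => x.
by rewrite [RHS]UT; apply/esym/scalemxAl.
Qed.
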